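(* Let $K$ be an algebraically closed field, let $A$ be a connected non-semisimple linear Nakayama algebra over $K$ with $n$ simple modules, and let $r=\lambda_1(A)$. Then the global dimension of $A$ is equal to $r$ if and only if the defining relations of $A$ form a chain.
   Context: Algebras are finite dimensional over $K$ and of the form $A=KQ/I$ with $I$ admissible. A Nakayama algebra is an algebra such that every indecomposable module has a unique composition series; a connected one is linear if its quiver is acyclic, so $Q$ is $1\to2\to\cdots\to n$ with arrows $\alpha_i:i\to i+1$ ($1\le i\le n-1$), and modules are taken so that the indecomposable projective at vertex $i$ has as basis the nonzero paths starting at $i$ (so $S_n$ is simple projective). $\lambda_1(A)$ is the number of isomorphism classes of simple $A$-modules with projective dimension not equal to $1$. By convention one includes a formal relation ''$\alpha_n=0$'' at the vertex $n$, corresponding to the simple projective $S_n$; with this convention $r=\lambda_1(A)$ is the number of defining relations, so that $I$ is minimally generated by $r-1$ paths. Write these $r-1$ paths as $\rho_1,\dots,\rho_{r-1}$, where $\rho_i$ is the path running through the arrows $\alpha_{k_{2i-1}},\alpha_{k_{2i-1}+1},\dots,\alpha_{k_{2i}}$ with $k_{2i-1}<k_{2i}$, ordered such that $1\le k_1<k_3<\cdots<k_{2r-3}$ and $k_2<k_4<\cdots<k_{2r-2}<n$. The defining relations form a chain if $k_{2i+1}\le k_{2i}$ for all $1\le i\le r-2$ and $k_{2i}<k_{2i+3}$ for all $1\le i\le r-3$ (no condition when $r\le 2$). *)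

(* Defs.v *)
(* Modules are left modules (lmodType A), so products
   of paths are written right to left: q * p means "first p, then q".  With this
   convention A * e_a has as basis the nonzero paths starting at the vertex a. *)
From HB Require Import structures.
From mathcomp Require Import all_boot all_order all_algebra all_field.

Set Implicit Arguments.
Unset Strict Implicit.
Unset Printing Implicit Defensive.

Import GRing.Theory.
Local Open Scope ring_scope.

Section Modules.
Variable A : nzRingType.

Definition module_iso (M N : lmodType A) : Prop :=
  exists f : {linear M -> N}, bijective f.

Definition simple_module (M : lmodType A) : Prop :=
  (exists x : M, x <> 0) /\
  forall S : {pred M}, submod_closed S -> S =i pred1 0 \/ S =i predT.

Definition internal_direct_sum (M : lmodType A) (S T : {pred M}) : Prop :=
  (forall x, x \in S -> x \in T -> x = 0) /\
  (forall x, exists s t, [/\ s \in S, t \in T & x = s + t]).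

Definition indecomposable_module (M : lmodType A) : Prop :=
  (exists x : M, x <> 0) /\
  forall S T : {pred M}, submod_closed S -> submod_closed T ->
    internal_direct_sum S T -> S =i pred1 0 \/ T =i pred1 0.

(* Every submodule is a direct summand. *)
Definition semisimple_module (M : lmodType A) : Prop :=
  forall S : {pred M}, submod_closed S ->
    exists2 T : {pred M}, submod_closed T & internal_direct_sum S T.

Definition semisimple_ring : Prop := semisimple_module A^o.

(* 0 = N_0 < N_1 < ... < N_l = M with simple factors; only the values N i
   with i <= l matter. *)
Definition composition_series (M : lmodType A) (l : nat) (N : nat -> {pred M}) :
    Prop :=
  [/\ forall i, (i <= l)%N -> submod_closed (N i),
      N 0%N =i pred1 0,
      N l =i predT &
      forall i, (i < l)%N ->
        [/\ {subset N i <= N i.+1},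
            ~ (N i =i N i.+1) &
            forall S : {pred M}, submod_closed S ->
              {subset N i <= S} -> {subset S <= N i.+1} ->
              S =i N i \/ S =i N i.+1]].

Definition unique_composition_series (M : lmodType A) : Prop :=
  exists (l : nat) (N : nat -> {pred M}), composition_series l N /\
    forall (l' : nat) (N' : nat -> {pred M}), composition_series l' N' ->
      l' = l /\ forall i, (i <= l)%N -> N' i =i N i.

Definition projective_module (P : lmodType A) : Prop :=
  forall (M N : lmodType A) (f : {linear M -> N}) (g : {linear P -> N}),
    (forall y, exists x, f x = y) ->
    exists h : {linear P -> M}, forall x, f (h x) = g x.

(* There is a projective resolution
   0 -> P_m -> ... -> P_1 -> P_0 -> M -> 0. *)
Definition pdim_le (M : lmodType A) (m : nat) : Prop :=
  exists (P : nat -> lmodType A) (d : forall i, {linear P i.+1 -> P i})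
         (e : {linear P 0%N -> M}),
    [/\ forall i, projective_module (P i),
        forall y, exists x, e x = y,
        forall x, e x = 0 <-> exists z, d 0%N z = x,
        forall i x, d i x = 0 <-> exists z, d i.+1 z = x &
        forall i, (m < i)%N -> forall x : P i, x = 0].

(* The projective dimension of M is finite and equal to m. *)
Definition has_pdim (M : lmodType A) (m : nat) : Prop :=
  pdim_le M m /\ forall k, pdim_le M k -> (m <= k)%N.

(* r is the number of isomorphism classes of simple modules whose projective
   dimension (possibly infinite) is not 1. *)
Definition has_lambda1 (r : nat) : Prop :=
  exists S : 'I_r -> lmodType A,
    [/\ forall i, simple_module (S i) /\ ~ has_pdim (S i) 1,
        forall i j, module_iso (S i) (S j) -> i = j &
        forall M : lmodType A, simple_module M -> ~ has_pdim M 1 ->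
          exists i, module_iso M (S i)].

End Modules.

Section Algebras.
Variables (K : fieldType) (A : falgType K).

Definition finite_dim_module (M : lmodType A) : Prop :=
  exists s : seq M, forall x : M,
    exists c : 'I_(size s) -> K, x = \sum_i (c i)%:A *: s`_i.

Definition nakayama : Prop :=
  forall M : lmodType A, finite_dim_module M -> indecomposable_module M ->
    unique_composition_series M.

(* The global dimension of A is finite and equal to g, i.e. g is the supremum
   of the projective dimensions of the finite dimensional modules. *)
Definition has_gldim (g : nat) : Prop :=
  (forall M : lmodType A, finite_dim_module M -> pdim_le M g) /\
  forall m, (forall M : lmodType A, finite_dim_module M -> pdim_le M m) ->
    (g <= m)%N.

End Algebras.

(* Paths of the quiver 1 -> 2 -> ... -> n.  A path is determined by its source a
   and target b, where 1 <= a <= b <= n: it is alpha_a, ..., alpha_(b-1), and it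
   is the trivial path e_a if a = b. *)
Definition lpath (n : nat) :=
  {p : 'I_n.+1 * 'I_n.+1 | (0 < p.1)%N && (p.1 <= p.2)%N}.
Definition src n (p : lpath n) : 'I_n.+1 := (val p).1.
Definition tgt n (p : lpath n) : 'I_n.+1 := (val p).2.
Definition path_length n (p : lpath n) : nat := (tgt p - src p)%N.

(* The path algebra KQ: linear combinations of paths. *)
Definition path_alg (K : fieldType) (n : nat) := {ffun lpath n -> K^o}.

Section PathAlgebra.
Variables (K : fieldType) (n : nat).
Local Notation KQ := (path_alg K n).

HB.instance Definition _ := GRing.Lmodule.on KQ.

(* Coefficient of the path from a to b, and 0 if there is no such path. *)
Definition pcoef (x : KQ) (a b : 'I_n.+1) : K :=
  oapp (fun p : lpath n => x p) 0 (insub (a, b)).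

Definition path_one : KQ := [ffun p => (src p == tgt p)%:R].

Definition path_mul (x y : KQ) : KQ :=
  [ffun p => \sum_(c < n.+1) pcoef x c (tgt p) * pcoef y (src p) c].

Lemma pcoefE (x : KQ) p : x p = pcoef x (src p) (tgt p).
Proof. by rewrite /pcoef /src /tgt -surjective_pairing valK. Qed.

Lemma pcoef_eq0 (x : KQ) (a b : 'I_n.+1) :
  ~~ ((0 < a)%N && (a <= b)%N) -> pcoef x a b = 0.
Proof. by move=> h; rewrite /pcoef insubN. Qed.

Lemma pcoef_mul x y a b :
  pcoef (path_mul x y) a b = \sum_(c < n.+1) pcoef x c b * pcoef y a c.
Proof.
have [h|h] := boolP ((0 < a)%N && (a <= b)%N).
  by rewrite {1}/pcoef insubT /= ffunE.
rewrite pcoef_eq0 // big1 // => c _.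
have [h1|h1] := boolP ((0 < a)%N && (a <= c)%N); last first.
  by rewrite (pcoef_eq0 y h1) mulr0.
rewrite (@pcoef_eq0 x c b) ?mul0r //; apply: contra h => /andP[_ cb].
by case/andP: h1 => -> /leq_trans ->.
Qed.

Lemma pcoef_one a b : pcoef path_one a b = ((a == b) && (0 < a)%N)%:R.
Proof.
have [h|h] := boolP ((0 < a)%N && (a <= b)%N).
  by rewrite /pcoef insubT /= ffunE; case/andP: (h) => -> _; rewrite andbT.
rewrite pcoef_eq0 //; case: eqP h => //= <-.
by rewrite leqnn andbT => /negPf ->.
Qed.

Lemma pcoefD x y a b : pcoef (x + y) a b = pcoef x a b + pcoef y a b.
Proof. by rewrite /pcoef; case: insubP => [p|] _ /=; rewrite ?ffunE ?addr0. Qed.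

Lemma path_mulA : associative path_mul.
Proof.
move=> x y z; apply/ffunP => p; rewrite !ffunE.
under eq_bigr do rewrite pcoef_mul mulr_sumr.
under [RHS]eq_bigr do rewrite pcoef_mul mulr_suml.
rewrite exchange_big; apply: eq_bigr => c _; apply: eq_bigr => d _.
by rewrite mulrA.
Qed.

Lemma path_mul1 : left_id path_one path_mul.
Proof.
move=> x; apply/ffunP => p; rewrite ffunE (bigD1 (tgt p)) //= big1 => [|c /negPf cp].
  rewrite pcoef_one eqxx addr0 /= pcoefE.
  suff -> : (0 < tgt p)%N by rewrite mul1r.
  by case/andP: (valP p) => a b; apply: leq_trans b.
by rewrite pcoef_one cp mul0r.
Qed.

Lemma path_mulr1 : right_id path_one path_mul.
Proof.
move=> x; apply/ffunP => p; rewrite ffunE (bigD1 (src p)) //= big1 => [|c cp].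
  rewrite pcoef_one eqxx addr0 /= [RHS]pcoefE.
  suff -> : (0 < src p)%N by rewrite mulr1.
  by case/andP: (valP p).
by rewrite pcoef_one eq_sym (negPf cp) mulr0.
Qed.

Lemma path_mulDl : left_distributive path_mul +%R.
Proof.
move=> x y z; apply/ffunP => p; rewrite !ffunE -big_split /=.
by apply: eq_bigr => c _; rewrite pcoefD mulrDl.
Qed.

Lemma path_mulDr : right_distributive path_mul +%R.
Proof.
move=> x y z; apply/ffunP => p; rewrite !ffunE -big_split /=.
by apply: eq_bigr => c _; rewrite pcoefD mulrDr.
Qed.

(* Possibly trivial ring, since n = 0 is allowed. *)
HB.instance Definition _ := GRing.Zmodule_isPzRing.Build KQ
  path_mulA path_mul1 path_mulr1 path_mulDl path_mulDr.

Definition path_elt (a b : nat) : KQ :=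
  [ffun p => ((src p == a :> nat) && (tgt p == b :> nat))%:R].

Definition two_sided_ideal (I : {pred KQ}) : Prop :=
  [/\ 0 \in I,
      forall x y, x \in I -> y \in I -> x + y \in I &
      forall x y, y \in I -> x * y \in I /\ y * x \in I].

(* x belongs to the m-th power of the arrow ideal: it is a combination of paths
   of length at least m. *)
Definition in_arrow_ideal_power (m : nat) (x : KQ) : Prop :=
  forall p : lpath n, (path_length p < m)%N -> x p = 0.

Definition admissible (I : {pred KQ}) : Prop :=
  [/\ two_sided_ideal I,
      forall x, x \in I -> in_arrow_ideal_power 2 x &
      exists2 m, (2 <= m)%N & forall x, in_arrow_ideal_power m x -> x \in I].

Definition generates (I : {pred KQ}) (s : seq KQ) : Prop :=
  [/\ two_sided_ideal I,
      {subset s <= I} &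
      forall J : {pred KQ}, two_sided_ideal J -> {subset s <= J} ->
        {subset I <= J}].

Definition minimally_generates (I : {pred KQ}) (s : seq KQ) : Prop :=
  generates I s /\ forall t, subseq t s -> generates I t -> t = s.

(* A relation is encoded by the pair (k, l) of its first and last arrows: it is
   the path alpha_k, ..., alpha_l from the vertex k to the vertex l + 1. *)
Definition rel_path (k : nat * nat) : KQ := path_elt k.1 k.2.+1.

Definition defining_relations (I : {pred KQ}) (rho : seq (nat * nat)) : Prop :=
  [/\ forall k, k \in rho -> [/\ (1 <= k.1)%N, (k.1 < k.2)%N & (k.2 < n)%N],
      sorted ltn [seq k.1 | k <- rho],
      sorted ltn [seq k.2 | k <- rho] &
      minimally_generates I [seq rel_path k | k <- rho]].

(* A is isomorphic to KQ / I as a K-algebra. *)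
Definition bound_quiver_algebra (I : {pred KQ}) (A : falgType K) : Prop :=
  exists pi : {linear KQ -> A},
    [/\ monoid_morphism pi,
        forall a, exists x, pi x = a &
        forall x, (x \in I) = (pi x == 0)].

End PathAlgebra.

(* With rho = [:: (k_1, k_2); (k_3, k_4); ...], indexed from 0 by nth, this says
   k_(2i+1) <= k_(2i) and k_(2i) < k_(2i+3) whenever both sides exist. *)
Definition forms_chain (rho : seq (nat * nat)) : Prop :=
  (forall i, (i.+1 < size rho)%N ->
     ((nth (0, 0) rho i.+1).1 <= (nth (0, 0) rho i).2)%N) /\
  (forall i, (i.+2 < size rho)%N ->
     ((nth (0, 0) rho i).2 < (nth (0, 0) rho i.+2).1)%N).

(* Main.v *)
From HB Require Import structures.
From mathcomp Require Import all_boot all_order all_algebra all_field.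
From mathcomp Require Import boolp.
Require Import Defs.

Set Implicit Arguments.
Unset Strict Implicit.
Unset Printing Implicit Defensive.

Import GRing.Theory.
Local Open Scope ring_scope.

(** Write a -> b for the path of the quiver from a to b.  Let f a be the least
    vertex b such that a -> b is zero in A, with f a = n + 1 if there is none:
    it is the end of the first relation that starts at or after a.  The function
    f is monotone, and a -> b is nonzero exactly when a <= b < f a.

    The left ideal A (a -> b) is the interval module with vertices b, ...,
    f a - 1.  Right multiplication by a -> b maps the projective A e_b onto it,
    with kernel A (b -> f a) [path_ideal_exact], so that its syzygies are again
    left ideals generated by paths, read off from the sequence
      a, b, f a, f b, f (f a), f (f b), ...
    Such an ideal is projective if and only if f a = f b
    [path_ideal_projectiveP].  As projective dimension can be computed from any
    presentation (Schanuel, [pd_le_kernel]), this determines the projective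
    dimension of every path ideal, and of the simple module S_a, whose first
    syzygy is generated by the arrow a -> a + 1 [pd_le_simple_at].

    In particular S_a has projective dimension 1 unless a = n or a relation
    starts at a, hence r = size rho + 1 [lambda1_size].  By the horseshoe lemma
    [pd_le_extension] a bound for the simple modules bounds all the finite
    dimensional ones, so that the global dimension is reached at a simple.

    It remains to see how long the sequence above can grow when it starts with
    a, a + 1.  Its terms f x are ends of relations, and as long as it grows these
    relations advance; since there are r of them, counting the formal one at n,
    the dimension is at most r.  It equals r if and only if no relation is
    skipped: the sequence starts at the first relation, and the first relation
    that starts at or after the end of the j-th one is the (j + 2)-nd, for each
    j.  This last condition is the definition of a chain [chainP]. *)

(** * Projective dimension by dimension shifting *)
Section Homological.
Variable R : nzRingType.
Implicit Types K M N P X : lmodType R.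

Definition lin_of M N (f : M -> N) (lf : linear f) : {linear M -> N} :=
  HB.pack f (GRing.isLinear.Build R M N _ f lf).

Fact inl_is_linear M N : linear (fun x : M => (x, 0) : M * N).
Proof. by move=> a x y; congr (_, _); rewrite /= ?scaler0 ?addr0. Qed.
Definition inl_lin M N : {linear M -> (M * N)%type} :=
  lin_of (@inl_is_linear M N).

Fact inr_is_linear M N : linear (fun x : N => (0, x) : M * N).
Proof. by move=> a x y; congr (_, _); rewrite /= ?scaler0 ?addr0. Qed.
Definition inr_lin M N : {linear N -> (M * N)%type} :=
  lin_of (@inr_is_linear M N).

Fact zero_is_linear M N : linear (fun _ : M => 0 : N).
Proof. by move=> a x y; rewrite scaler0 addr0. Qed.
Definition zero_lin M N : {linear M -> N} := lin_of (@zero_is_linear M N).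

Section Submodule.
Variables (M : lmodType R) (S : {pred M}).
Definition submod_pred (clS : submod_closed S) : {pred M} := S.
Variable clS : submod_closed S.
HB.instance Definition _ :=
  GRing.isSubmodClosed.Build R M (submod_pred clS) clS.
Definition submod := {x : M | x \in submod_pred clS}.
HB.instance Definition _ := SubType.on submod.
HB.instance Definition _ := [Choice of submod by <:].
HB.instance Definition _ := [SubChoice_isSubLmodule of submod by <:].
End Submodule.

(** Submodules are handled as modules with an injection, and kernels up to
    isomorphism: explicit modules can then be used as syzygies. *)
Lemma submodule_exists M (S : M -> Prop) :
    S 0 -> (forall a x y, S x -> S y -> S (a *: x + y)) ->
  exists (K : lmodType R) (i : {linear K -> M}),
    injective i /\ forall x, S x <-> exists k, i k = x.
Proof.
move=> S0 SZD; pose T : {pred M} := fun x => `[< S x >].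
have clT : submod_closed T.
  split; first exact/asboolP.
  by move=> a x y /asboolP Sx /asboolP Sy; apply/asboolP/SZD.
exists (submod clT), val; split; first exact: val_inj.
move=> x; split=> [Sx | [k <-]]; last by have /asboolP := valP k.
by have Tx : x \in submod_pred clT by [apply/asboolP]; exists (Sub x Tx).
Qed.

Definition short_exact K P M : Prop :=
  exists (i : {linear K -> P}) (p : {linear P -> M}),
    [/\ injective i, forall y, exists x, p x = y &
        forall x, p x = 0 <-> exists k, i k = x].

Fixpoint pd_le (m : nat) M : Prop :=
  if m is m'.+1 then
    exists K P, [/\ short_exact K P M, projective_module P & pd_le m' K]
  else projective_module M.

Lemma kernel_exists P M (p : {linear P -> M}) :
  exists (K : lmodType R) (i : {linear K -> P}),
    injective i /\ forall x, p x = 0 <-> exists k, i k = x.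
Proof.
apply: submodule_exists => [|a x y px py]; first exact: linear0.
by rewrite linearP px py scaler0 addr0.
Qed.

(** All maps into a kernel or a left ideal are obtained from this factorization,
    by choice of preimages; injectivity makes the chosen map linear. *)
Lemma factor_inj K N M (i : {linear K -> M}) (g : {linear N -> M}) :
    injective i -> (forall y, exists x, i x = g y) ->
  exists h : {linear N -> K}, forall y, i (h y) = g y.
Proof.
move=> inj_i /choice[h ih].
have lh : linear h by move=> a x y; apply: inj_i; rewrite linearP !ih linearP.
by exists (lin_of lh).
Qed.

Lemma retract_projective X K (s : {linear K -> X}) (t : {linear X -> K}) :
  cancel s t -> projective_module X -> projective_module K.
Proof.
move=> sK prX M N f g f_surj; have [h fh] := prX M N f (g \o t) f_surj.
by exists (h \o s) => x /=; rewrite fh /= sK.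
Qed.

Lemma prod_projective P Q :
  projective_module P -> projective_module Q ->
  projective_module (P * Q)%type.
Proof.
move=> prP prQ M N f g f_surj.
have [hP fhP] := prP M N f (g \o inl_lin P Q) f_surj.
have [hQ fhQ] := prQ M N f (g \o inr_lin P Q) f_surj.
exists ((hP \o fst) \+ (hQ \o snd)) => -[x y] /=.
rewrite linearD fhP fhQ /= -linearD; congr (g _).
by congr (_, _); rewrite /= ?addr0 ?add0r.
Qed.

Lemma section_exists P M (p : {linear P -> M}) :
    projective_module M -> (forall y, exists x, p x = y) ->
  exists s : {linear M -> P}, cancel s p.
Proof. by move=> prM p_surj; have [s] := prM P M p idfun p_surj; exists s. Qed.

(** The extension splits, so M is a retract of K * N. *)
Lemma extension_projective K M N :
    short_exact K M N -> projective_module K -> projective_module N ->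
  projective_module M.
Proof.
move=> [i [p [inj_i p_surj kerp]]] prK prN.
have [s ps] := section_exists prN p_surj.
have [y|h ih] := @factor_inj K M M i (idfun \- (s \o p)) inj_i.
  by apply/kerp; rewrite /= linearB ps subrr.
have lh : linear (fun x : M => (h x, p x)).
  by move=> a x y; rewrite !linearP.
apply: (@retract_projective (K * N)%type M (lin_of lh)
  ((i \o fst) \+ (s \o snd))).
  by move=> x /=; rewrite ih /= subrK.
exact: prod_projective.
Qed.

Lemma zero_projective M : (forall x : M, x = 0) -> projective_module M.
Proof.
move=> M0 X Y f g _; exists (zero_lin M X) => x /=.
by rewrite (M0 x) !linear0.
Qed.

Lemma short_exact_id M (Z : lmodType R) :
  (forall z : Z, z = 0) -> short_exact Z M M.
Proof.
move=> Z0; exists (zero_lin Z M), idfun; split=> [x y _ | y | x] /=.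
- by rewrite (Z0 x) (Z0 y).
- by exists y.
- by split=> [-> | [_ <-] //]; exists 0.
Qed.

Lemma zero_module_exists : exists Z : lmodType R, forall z : Z, z = 0.
Proof.
have [|a x y -> ->|Z [i [inj_i imi]]] :=
  @submodule_exists R^o (fun x => x = 0).
- by [].
- by rewrite scaler0 addr0.
exists Z => z; apply: inj_i; rewrite linear0.
by apply/imi; exists z.
Qed.

Lemma pd_leS m M : pd_le m M -> pd_le m.+1 M.
Proof.
elim: m M => [|m IHm] M /=.
  move=> prM; have [Z Z0] := zero_module_exists; exists Z, M.
  by split=> //; [apply: short_exact_id | apply: zero_projective].
by move=> [K [P [ex prP /IHm pdK]]]; exists K, P.
Qed.

Lemma pd_leW m k M : (m <= k)%N -> pd_le m M -> pd_le k M.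
Proof.
by move/subnK <-; elim: (k - m)%N => //= j IHj /IHj; apply: pd_leS.
Qed.

(** Horseshoe lemma.  A presentation P1 -> K and a lift P2 -> M of a presentation
    P2 -> N together give a presentation of M by P1 * P2, whose kernel is an
    extension of the kernel K2 by the kernel K1. *)
Lemma pd_le_extension m K M N :
  short_exact K M N -> pd_le m K -> pd_le m N -> pd_le m M.
Proof.
elim: m K M N => [|m IHm] K M N; first exact: extension_projective.
move=> [i [p [inj_i p_surj kerp]]].
move=> [K1 [P1 [[j1 [q1 [inj_j1 q1_surj kerq1]]] prP1 pdK1]]].
move=> [K2 [P2 [[j2 [q2 [inj_j2 q2_surj kerq2]]] prP2 pdK2]]].
have [t pt] := prP2 M N p q2 p_surj.
pose q : {linear (P1 * P2)%type -> M} := (i \o q1 \o fst) \+ (t \o snd).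
have [L [l [inj_l kerq]]] := kernel_exists q.
have pi0 x : p (i x) = 0 by apply/kerp; exists x.
have imL x : exists z, j2 z = (l x).2.
  apply/kerq2; rewrite -pt.
  have : q (l x) = 0 by apply/kerq; exists x.
  by move/(congr1 p); rewrite /= linearD pi0 add0r linear0.
have [h jh] := @factor_inj K2 L P2 j2 (snd \o l) inj_j2 imL.
have [y|u lu] := @factor_inj L K1 (P1 * P2)%type l (inl_lin P1 P2 \o j1) inj_l.
  apply/kerq => /=; have -> : q1 (j1 y) = 0 by apply/kerq1; exists y.
  by rewrite !linear0 addr0.
exists L, (P1 * P2)%type; split; last 1 first.
- apply: IHm pdK1 pdK2; exists u, h; split.
  + by move=> x y /(congr1 l); rewrite !lu /= => -[/inj_j1].
  + move=> y; have [x1 x1E] : exists x1, i (q1 x1) = t (j2 y).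
      have [|x ix] := (kerp (t (j2 y))).1.
        by rewrite pt; apply/kerq2; exists y.
      by have [x1 qx1] := q1_surj x; exists x1; rewrite qx1.
    (* correct the lift of j2 y by an element of P1 to land in the kernel *)
    have [|x lx] := (kerq (- x1, j2 y)).1.
      by rewrite /= !linearN x1E addNr.
    by exists x; apply: inj_j2; rewrite jh /= lx.
  + move=> x; split=> [hx0 | [y <-]].
      have l2 : (l x).2 = 0 by rewrite -[LHS]jh hx0 linear0.
      have [|y jy] := (kerq1 (l x).1).1.
        have : q (l x) = 0 by apply/kerq; exists x.
        rewrite /= l2 linear0 addr0 -[0](linear0 i) => /inj_i; exact.
      by exists y; apply: inj_l; rewrite lu /= jy -l2; case: (l x).
    by apply: inj_j2; rewrite jh /= lu /= linear0.
- exists l, q; split=> // y.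
  have [x2 x2E] := q2_surj (p y).
  have [|z iz] := (kerp (y - t x2)).1; first by rewrite linearB pt x2E subrr.
  have [x1 x1E] := q1_surj z.
  by exists (x1, x2); rewrite /= x1E iz subrK.
- exact: prod_projective.
Qed.

(** Given presentations P -> M and P' -> M with kernels K and K', the pullback X
    of P and P' is an extension of P by K', and K is a retract of X because
    X -> P' splits.  Closure under retracts is a hypothesis here because
    [pd_le_retract] deduces it in dimension m + 1 from this lemma for m. *)
Lemma schanuel m :
    (forall X K (s : {linear K -> X}) (t : {linear X -> K}),
       cancel s t -> pd_le m X -> pd_le m K) ->
  forall K P M, short_exact K P M -> projective_module P ->
    pd_le m.+1 M -> pd_le m K.
Proof.
move=> retr K P M [i [p [inj_i p_surj kerp]]] prP.
move=> [K' [P' [[i' [p' [inj_i' p'_surj kerp']]] prP' pdK']]].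
pose d : {linear (P * P')%type -> M} := (p \o fst) \- (p' \o snd).
have [X [l [inj_l kerd]]] := kernel_exists d.
have eqX x : p (l x).1 = p' (l x).2.
  by apply/eqP; rewrite -subr_eq0; apply/eqP/kerd; exists x.
have pdX : pd_le m X.
  apply: (@pd_le_extension m K' X P) => //; last exact: (@pd_leW 0).
  have [y|u lu] :=
    @factor_inj X K' (P * P')%type l (inr_lin P P' \o i') inj_l.
    apply/kerd => /=; have -> : p' (i' y) = 0 by apply/kerp'; exists y.
    by rewrite linear0 subrr.
  exists u, (fst \o l); split=> /=.
  - by move=> x y /(congr1 l); rewrite !lu /= => -[/inj_i'].
  - move=> x; have [x' x'E] := p'_surj (p x).
    have [|z lz] := (kerd (x, x')).1; first by rewrite /= x'E subrr.
    by exists z; rewrite lz.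
  - move=> x; split=> [l1 | [y <-]]; last by rewrite lu.
    have [|y iy] := (kerp' (l x).2).1; first by rewrite -eqX l1 linear0.
    by exists y; apply: inj_l; rewrite lu /= iy -l1; case: (l x).
have [y|u lu] := @factor_inj X K (P * P')%type l (inl_lin P P' \o i) inj_l.
  apply/kerd => /=; have -> : p (i y) = 0 by apply/kerp; exists y.
  by rewrite linear0 subrr.
(* the section s of X -> P' gives the projection x |-> x - s (x.2) onto K *)
have [|s sK] := @section_exists X P' (snd \o l) prP'.
  move=> x'; have [x xE] := p_surj (p' x').
  have [|z lz] := (kerd (x, x')).1; first by rewrite /= xE subrr.
  by exists z; rewrite /= lz.
pose g : {linear X -> P} := (fst \o l) \o (idfun \- (s \o (snd \o l))).
have [y|t it] := @factor_inj K X P i g inj_i.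
  by apply/kerp; rewrite /= eqX linearB /= [(l (s _)).2]sK subrr linear0.
apply: (retr X K u t) => // x; apply: inj_i; rewrite it.
suff -> : g (u x) = (l (u x)).1 by rewrite lu.
have ux0 : (l (u x)).2 = 0 by rewrite lu.
by rewrite /g /= ux0 linear0 subr0.
Qed.

(** For a presentation p : P -> X, the map (a, b) |-> s t p a + (1 - s t) p b
    presents X by P * P.  Its kernel has dimension at most m by [schanuel], and
    the kernel of t p : P -> K is a retract of it through a |-> (a, 0). *)
Lemma pd_le_retract m X K (s : {linear K -> X}) (t : {linear X -> K}) :
  cancel s t -> pd_le m X -> pd_le m K.
Proof.
elim: m X K s t => [|m IHm] X K s t sK; first exact: retract_projective sK.
move=> pdX; have [L [P [[i [p [inj_i p_surj kerp]]] prP pdL]]] := pdX.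
have [N [j [inj_j kerj]]] := kernel_exists (t \o p).
exists N, P; split=> //.
  exists j, (t \o p); split=> // y.
  by have [x xE] := p_surj (s y); exists x; rewrite /= xE sK.
pose q : {linear (P * P)%type -> X} :=
  (s \o t \o p \o fst) \+ ((idfun \- (s \o t)) \o p \o snd).
have [Q [l [inj_l kerq]]] := kernel_exists q.
have pdQ : pd_le m Q.
  apply: (@schanuel m IHm Q (P * P)%type X) => //; last exact: prod_projective.
  exists l, q; split=> // x; have [y yE] := p_surj x.
  by exists (y, y) => /=; rewrite yE addrCA subrr addr0.
have [y|u lu] := @factor_inj Q N (P * P)%type l (inl_lin P P \o j) inj_l.
  apply/kerq => /=; have /= -> : (t \o p) (j y) = 0 by apply/kerj; exists y.
  by rewrite !linear0 !addr0.
have [y|v jv] := @factor_inj N Q P j (fst \o l) inj_j.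
  apply/kerj => /=; have : q (l y) = 0 by apply/kerq; exists y.
  by move/(congr1 t); rewrite /= linearD linearB !sK subrr addr0 linear0.
apply: (IHm Q N u v) => // x; apply: inj_j.
by rewrite jv /= lu.
Qed.

(** Dimension shifting: the recursion in [pd_le], which asks for some
    presentation, can be run along any given one. *)
Lemma pd_le_kernel m K P M :
    short_exact K P M -> projective_module P ->
  pd_le m.+1 M <-> pd_le m K.
Proof.
move=> ex prP; split=> [|pdK]; last by exists K, P.
exact: schanuel (@pd_le_retract m) _ _ _ ex prP.
Qed.

Lemma module_iso_sym M N : module_iso M N -> module_iso N M.
Proof.
move=> [f [g fK gK]].
have [y|h fh] := @factor_inj M N N f idfun (can_inj fK).
  by exists (g y); rewrite gK.
by exists h; exists f => // x; apply: (can_inj fK); rewrite fh.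
Qed.

Lemma pd_le_iso m M N : module_iso M N -> pd_le m M -> pd_le m N.
Proof.
move=> [f [g fK gK]].
have [y|h fh] := @factor_inj M N N f idfun (can_inj fK).
  by exists (g y); rewrite gK.
by apply: (@pd_le_retract m M N h f) => y; apply: fh.
Qed.

Lemma zero_kernel_projective K P M :
    short_exact K P M -> (forall x : K, x = 0) -> projective_module P ->
  projective_module M.
Proof.
move=> [i [p [_ p_surj kerp]]] K0.
apply: (@pd_le_iso 0); exists p; have [g pg] := choice p_surj; exists g => // x.
apply/eqP; rewrite -subr_eq0; apply/eqP.
have [|k <-] := (kerp (g (p x) - x)).1; first by rewrite linearB pg subrr.
by rewrite (K0 k) linear0.
Qed.

(** A resolution is cut after its first term, and rebuilt by splicing
    presentations. *)
Lemma pdim_leP M m : pdim_le M m <-> pd_le m M.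
Proof.
split; elim: m M => [|m IHm] M.
- move=> [P [d [e [prP e_surj exe _ P0]]]] /=.
  apply: (pd_le_iso (m := 0) (M := P 0%N) _ (prP 0%N)).
  have inj_e : injective e.
    move=> x y /eqP; rewrite -subr_eq0 -linearB => /eqP/exe[z dz].
    by apply/eqP; rewrite -subr_eq0 -dz (P0 1%N _ z) ?linear0.
  have [g eg] := choice e_surj.
  by exists e; exists g => // x; apply: inj_e; rewrite eg.
- move=> [P [d [e [prP e_surj exe exd P0]]]] /=.
  have [K [i [inj_i keri]]] := kernel_exists e.
  exists K, (P 0%N); split=> //; first by exists i, e.
  apply: IHm.
  have [y|e' ie'] := @factor_inj K (P 1%N) (P 0%N) i (d 0%N) inj_i.
    by apply/keri/exe; exists y.
  exists (fun k => P k.+1), (fun k => d k.+1), e'; split=> //.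
  + move=> y; have [|z dz] := (exe (i y)).1; first by apply/keri; exists y.
    by exists z; apply: inj_i; rewrite ie'.
  + move=> x; rewrite -exd -ie'; split=> [-> | ]; first exact: linear0.
    by rewrite -[X in _ = X](linear0 i) => /inj_i.
  + by move=> k mk; apply: P0.
- move=> prM; have [Z Z0] := zero_module_exists.
  pose res (k : nat) : lmodType R := if k is 0 then M else Z.
  pose d := (fun k => zero_lin Z (res k)) : forall k, {linear res k.+1 -> res k}.
  exists res, d, idfun; split.
  + by case=> [|k] //=; apply: zero_projective.
  + by move=> y; exists y.
  + by move=> x /=; split=> [-> | [_ <-] //]; exists 0.
  + by move=> k x /=; split=> // _; exists 0; rewrite (Z0 x).
  + by case.
- move=> [K [Q [[i [p [inj_i p_surj kerp]]] prQ pdK]]].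
  have [P [d [e [prP e_surj exe exd P0]]]] := IHm _ pdK.
  pose P' (k : nat) : lmodType R := if k is k'.+1 then P k' else Q.
  pose d' := (fun k => match k with
    0 => (i \o e : {linear P 0%N -> Q}) | k'.+1 => d k' end) :
    forall k, {linear P' k.+1 -> P' k}.
  exists P', d', p; split=> //.
  + by case.
  + move=> x; rewrite kerp; split=> [[k <-] | [z <-]].
      by have [z <-] := e_surj k; exists z.
    by exists (e z).
  + case=> [|k] x /=; last exact: exd.
    rewrite -exe; split=> [|->]; last exact: linear0.
    by rewrite -[X in _ = X](linear0 i) => /inj_i.
  + by case=> [|k] //; rewrite ltnS; apply: P0.
Qed.

End Homological.
(** * Combinatorics of the relations *)
Definition path_relations (n : nat) (rho : seq (nat * nat)) : Prop :=
  [/\ forall k, k \in rho -> [/\ (1 <= k.1)%N, (k.1 < k.2)%N & (k.2 < n)%N],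
      sorted ltn [seq k.1 | k <- rho] & sorted ltn [seq k.2 | k <- rho]].

Section Relations.
Variables (n : nat) (rho : seq (nat * nat)).

Definition rel_index (a : nat) : nat := find (fun k => a <= k.1)%N rho.

(** The index [size rho] stands for the formal relation at the vertex n, and the
    default value n makes it end at n + 1. *)
Definition rel_end (j : nat) : nat := (nth n [seq k.2 | k <- rho] j).+1.

(** Among the relations that start at or after a, the first one also ends first.
    So the path from a to b is nonzero in A if and only if a <= b < first_zero a.
    This is the function f of the introduction. *)
Definition first_zero (a : nat) : nat := rel_end (rel_index a).

(** In the sequence a, b, f a, f b, f (f a), ..., with terms numbered from 0, the
    terms k and k + 1 agree for some k with 2 <= k <= m + 2.  This means that the
    left ideal generated by the path from a to b has projective dimension at most
    m. *)
Fixpoint stops (m a b : nat) : bool :=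
  (first_zero a == first_zero b) ||
  (if m is m'.+1 then stops m' b (first_zero a) else false).

Hypothesis rels : path_relations n rho.

Lemma rho_bound k :
  k \in rho -> [/\ (1 <= k.1)%N, (k.1 < k.2)%N & (k.2 < n)%N].
Proof. by have [+ _ _] := rels; apply. Qed.

Lemma sorted1 : sorted ltn [seq k.1 | k <- rho].
Proof. by have [] := rels. Qed.

Lemma sorted2 : sorted ltn [seq k.2 | k <- rho].
Proof. by have [] := rels. Qed.

Lemma rel_index_mono a b : (a <= b)%N -> (rel_index a <= rel_index b)%N.
Proof. by move=> ab; apply: sub_find => k; apply: leq_trans. Qed.

Lemma rel_index_le a : (rel_index a <= size rho)%N.
Proof. exact: find_size. Qed.

Lemma rel_index_leP j a :
  (j < size rho)%N -> (rel_index a <= j)%N = (a <= (nth (0, 0)%N rho j).1)%N.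
Proof.
move=> js; apply/idP/idP => [ij | ale]; last first.
  by rewrite leqNgt; apply/negP => /(before_find (0, 0)%N); rewrite ale.
have ias : (rel_index a < size rho)%N by apply: leq_ltn_trans js.
have ha : (a <= (nth (0, 0)%N rho (rel_index a)).1)%N.
  by apply: (@nth_find _ (0, 0)%N (fun k => a <= k.1)%N); rewrite has_find.
apply: (leq_trans ha); case: (ltngtP (rel_index a) j) ij => // [lt _ | -> //].
rewrite -!(nth_map _ 0%N) // ltnW //.
by apply: (sorted_ltn_nth ltn_trans 0%N sorted1); rewrite ?inE ?size_map.
Qed.

Lemma rel_endE j : (j < size rho)%N -> rel_end j = (nth (0, 0)%N rho j).2.+1.
Proof. by move=> js; rewrite /rel_end (nth_map (0, 0)%N). Qed.

Lemma rel_end_lt i j :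
  (i < j)%N -> (j <= size rho)%N -> (rel_end i < rel_end j)%N.
Proof.
move=> ij js; have is_ := leq_trans ij js; rewrite /rel_end ltnS.
have [jlt | sj] := ltnP j (size rho).
  by apply: (sorted_ltn_nth ltn_trans n sorted2); rewrite ?inE ?size_map.
rewrite (nth_default _ (_ : size _ <= j)%N) ?size_map //.
rewrite (nth_map (0, 0)%N) //.
by have [] := rho_bound (mem_nth (0, 0)%N is_).
Qed.

Lemma first_zero_lt a b :
  (first_zero a < first_zero b)%N = (rel_index a < rel_index b)%N.
Proof.
case: (ltngtP (rel_index a) (rel_index b)) => [lt | lt | eq].
- by rewrite rel_end_lt ?rel_index_le.
- by apply/negbTE; rewrite -leqNgt ltnW // rel_end_lt ?rel_index_le.
- by rewrite /first_zero eq ltnn.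
Qed.

Lemma first_zero_eq a b :
  (first_zero a == first_zero b) = (rel_index a == rel_index b).
Proof.
by rewrite !eqn_leq ![(first_zero _ <= _)%N]leqNgt !first_zero_lt -!leqNgt.
Qed.

Lemma first_zero_mono a b : (a <= b)%N -> (first_zero a <= first_zero b)%N.
Proof. by move=> ab; rewrite leqNgt first_zero_lt -leqNgt rel_index_mono. Qed.

Lemma first_zero_leP a b : (b <= n)%N ->
  reflect (exists2 k, k \in rho & (a <= k.1)%N && (k.2 < b)%N)
          (first_zero a <= b)%N.
Proof.
move=> bn.
apply: (iffP idP) => [nb | [k /(nthP (0, 0)%N)[j js <-] /andP[ak kb]]].
  have ias : (rel_index a < size rho)%N.
    rewrite ltnNge; apply/negP => sia.
    move: nb; rewrite /first_zero /rel_end nth_default ?size_map //.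
    by rewrite ltnNge bn.
  exists (nth (0, 0)%N rho (rel_index a)); first exact: mem_nth.
  by rewrite -rel_index_leP // leqnn -rel_endE.
apply: leq_trans kb; rewrite -rel_endE //.
move: ak; rewrite -rel_index_leP // leq_eqVlt => /predU1P[<- // | lt].
by rewrite ltnW // rel_end_lt // ltnW.
Qed.

Lemma first_zero_le a : (first_zero a <= n.+1)%N.
Proof.
rewrite ltnS; have [ias | sia] := ltnP (rel_index a) (size rho).
  rewrite (nth_map (0, 0)%N) // ltnW //.
  by have [] := rho_bound (mem_nth (0, 0)%N ias).
by rewrite nth_default ?size_map.
Qed.

Lemma first_zero_gt a : (a <= n)%N -> (a < first_zero a)%N.
Proof.
move=> an; rewrite ltnNge.
apply/negP => /(first_zero_leP _ an)[k kr /andP[ak ka]].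
have [_ k12 _] := rho_bound kr.
by move: (leq_trans (leq_trans k12 (ltnW ka)) ak); rewrite ltnn.
Qed.

Lemma first_zero_gt2 a : (a < n)%N -> (a.+1 < first_zero a)%N.
Proof.
move=> an; rewrite ltnNge.
apply/negP => /(first_zero_leP _ an)[k kr /andP[ak ka]].
have [_ k12 _] := rho_bound kr.
by move: (leq_trans (leq_trans k12 ka) ak); rewrite ltnn.
Qed.

Lemma rel_index_stepP a :
  (rel_index a < rel_index a.+1)%N = (a \in [seq k.1 | k <- rho]).
Proof.
apply/idP/mapP => [lt | [k /(nthP (0, 0)%N)[j js <-] ->]].
  have ias := leq_trans lt (rel_index_le a.+1).
  exists (nth (0, 0)%N rho (rel_index a)); first exact: mem_nth.
  apply/eqP; rewrite eqn_leq -rel_index_leP // leqnn.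
  by rewrite leqNgt -rel_index_leP // -ltnNge.
apply: (@leq_ltn_trans j); first by rewrite rel_index_leP.
by rewrite ltnNge rel_index_leP // ltnn.
Qed.

(** As long as the sequence does not stop, each term has a later relation index
    than the one before. *)
Lemma grows_rel_index m a b :
  ~~ stops m a b -> (a <= b)%N -> (b <= first_zero a)%N ->
  (rel_index a < rel_index b)%N && (rel_index b + m <= size rho)%N.
Proof.
elim: m a b => [|m IHm] a b /=; rewrite negb_or => /andP[neq].
all: move=> H ab bn; have lt : (rel_index a < rel_index b)%N.
1,3: by rewrite ltn_neqAle -first_zero_eq neq rel_index_mono.
  by rewrite lt addn0 rel_index_le.
have /andP[lt' le'] := IHm _ _ H bn (first_zero_mono ab).
by rewrite lt /= (leq_trans _ le') // addnS -addSn leq_add2r.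
Qed.

(** When just enough relations are left, the index has to grow by one at each
    step. *)
Lemma growsP m a b :
    (a <= b)%N -> (b <= first_zero a)%N ->
    rel_index b = (rel_index a).+1 -> (rel_index b + m)%N = size rho ->
  reflect (forall j, (rel_index a <= j)%N -> (j.+2 <= size rho)%N ->
             rel_index (rel_end j) = j.+2)
          (~~ stops m a b).
Proof.
elim: m a b => [|m IHm] a b ab bn ib im /=.
  rewrite orbF first_zero_eq ib neq_ltn leqnn /=.
  apply: ReflectT => j aj; rewrite -im addn0 ib ltnS => ja.
  by move: (leq_trans ja aj); rewrite ltnn.
rewrite negb_or first_zero_eq ib neq_ltn leqnn /=.
have nab := first_zero_mono ab.
have s2 : ((rel_index a).+2 <= size rho)%N.
  by rewrite -im ib addnS -addSn leq_addr.
apply: (iffP idP) => [gr | H].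
  have /andP[lt le] := grows_rel_index gr bn nab.
  have i2 : rel_index (first_zero a) = (rel_index a).+2.
    apply/eqP; rewrite eqn_leq -{2}ib lt andbT -(leq_add2r m).
    by rewrite (leq_trans le) // -im ib addnS addSn.
  have im' : (rel_index (first_zero a) + m)%N = size rho.
    by rewrite i2 -im ib addnS addSn.
  have /IHm H := gr; move: {H}(H bn nab).
  rewrite i2 ib => /(_ erefl); rewrite -i2 => /(_ im') H j.
  by rewrite leq_eqVlt => /predU1P[<- _ // | lt' js]; apply: H.
have i2 : rel_index (first_zero a) = (rel_index a).+2 by apply: H.
apply/IHm => //.
- by rewrite i2 ib.
- by rewrite i2 -im ib addnS addSn.
- by move=> j; rewrite ib => /ltnW; apply: H.
Qed.

(** For relations indexed from 0, the two families of inequalities of a chain say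
    that relation j + 1 starts before the end of relation j, and that relation
    j + 2 does not. *)
Lemma chainP :
  forms_chain rho <->
  (forall j, (j.+2 <= size rho)%N -> rel_index (rel_end j) = j.+2).
Proof.
split=> [[ch1 ch2] j js | H]; last first.
  split=> j js.
    have := ltnSn j.+1; rewrite -{2}(H j js).
    by rewrite ltnNge rel_index_leP // rel_endE ?(ltnW js) // -ltnNge.
  have := leqnn j.+2; rewrite -{1}(H j (ltnW js)).
  by rewrite rel_index_leP // rel_endE // ltnW // ltnW.
apply/eqP; rewrite eqn_leq; apply/andP; split.
  have [lt | ge] := ltnP j.+2 (size rho); last first.
    exact: leq_trans (rel_index_le _) ge.
  by rewrite rel_index_leP // rel_endE ?(ltnW (ltnW lt)) // ch2.
by rewrite ltnNge rel_index_leP // -ltnNge rel_endE ?(ltnW js) // ltnS ch1.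
Qed.

(** A sequence of maximal length starts at the first vertex of relation 0. *)
Lemma chain_growsP : (1 < n)%N ->
  forms_chain rho <->
  (exists i, [/\ (0 < i)%N, (i < n)%N &
     if size rho is s.+1 then ~~ stops s i i.+1 else true]).
Proof.
move=> n1; rewrite chainP; case E: (size rho) => [|s].
  by split=> [_ | _ j //]; exists 1%N.
have s0 : (0 < size rho)%N by rewrite E.
have [x0 x12 x2n] := rho_bound (mem_nth (0, 0)%N s0).
split=> [H | [i [i0 i_n gr]]].
  pose i := (nth (0, 0)%N rho 0).1; exists i.
  have i_n := ltn_trans x12 x2n.
  have ii : rel_index i = 0%N by apply/eqP; rewrite -leqn0 rel_index_leP.
  have ii1 : rel_index i.+1 = 1%N.
    apply/eqP; rewrite eqn_leq -{2}ii rel_index_stepP map_f ?mem_nth // andbT.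
    have [lt | ] := ltnP 1 (size rho); last exact: leq_trans (rel_index_le _).
    rewrite rel_index_leP // /i -!(nth_map _ 0%N (fun k => k.1)) //.
    by apply: (sorted_ltn_nth ltn_trans 0%N sorted1); rewrite ?inE ?size_map.
  split=> //; apply/growsP; rewrite ?ii ?ii1 ?E //.
  - by rewrite ltnW // first_zero_gt2.
  - by move=> j _; apply: H.
have le1 : (i.+1 <= first_zero i)%N by rewrite ltnW // first_zero_gt2.
have /andP[lt le] := grows_rel_index gr (leqnSn i) le1.
have i1 : rel_index i.+1 = 1%N.
  apply/eqP; rewrite eqn_leq (leq_trans _ lt) // andbT.
  by move: le; rewrite E -(add1n s) leq_add2r.
have i0' : rel_index i = 0%N by apply/eqP; rewrite -leqn0 -ltnS -i1.
move: gr => /growsP; rewrite i0' i1 E => /(_ (leqnSn i) le1 erefl erefl) H j.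
exact: H.
Qed.

Lemma stops_size i : (i < n)%N -> stops (size rho) i i.+1.
Proof.
move=> i_n; apply: contraT => gr.
have /andP[lt] := grows_rel_index gr (leqnSn i) (ltnW (first_zero_gt2 i_n)).
by rewrite -{2}[size rho]add0n leq_add2r leqn0 => /eqP i0; rewrite i0 in lt.
Qed.

End Relations.
(** * The algebra in coordinates *)
Definition nonzero_path (n : nat) (rho : seq (nat * nat)) (a b : nat) : bool :=
  [&& 0 < a, a <= b & b < first_zero n rho a]%N.

(** [cf x a b] is the coefficient in x of the path from a to b.  The axioms
    identify A with the tables of coefficients indexed by the nonzero paths, with
    the product of matrices. *)
Record coordinates (K : fieldType) (A : falgType K) (n : nat)
    (rho : seq (nat * nat)) := Coordinates {
  cf : A -> nat -> nat -> K;
  cfP : forall c x y a b, cf (c *: x + y) a b = c * cf x a b + cf y a b;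
  cf_mul : forall x y a b, nonzero_path n rho a b ->
    cf (x * y) a b = \sum_(a <= c < b.+1) cf x c b * cf y a c;
  cf_one : forall a b, nonzero_path n rho a b -> cf 1 a b = (a == b)%:R;
  cf_inj : forall x y,
    (forall a b, nonzero_path n rho a b -> cf x a b = cf y a b) -> x = y;
  cf_surj : forall g : nat -> nat -> K, exists x,
    forall a b, nonzero_path n rho a b -> cf x a b = g a b }.

(** The module K on which A acts through the character chi.  The argument chi is
    there for the module structure to be inferred from the type. *)
Definition charmod (A : nzRingType) (K : fieldType) (chi : {rmorphism A -> K}) :
  Type := K.

Section CharacterModule.
Variables (A : nzRingType) (K : fieldType) (chi : {rmorphism A -> K}).
HB.instance Definition _ := GRing.Zmodule.copy (charmod chi) K.
Definition charmod_scale (a : A) (v : charmod chi) : charmod chi := chi a * v.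
Fact charmod_scaleA a b v :
  charmod_scale a (charmod_scale b v) = charmod_scale (a * b) v.
Proof. by rewrite /charmod_scale rmorphM mulrA. Qed.
Fact charmod_scale1 : left_id 1 charmod_scale.
Proof. by move=> v; rewrite /charmod_scale rmorph1 mul1r. Qed.
Fact charmod_scaleDr : right_distributive charmod_scale +%R.
Proof. by move=> a u v; apply: mulrDr. Qed.
Fact charmod_scaleDl v : {morph charmod_scale^~ v : a b / a + b}.
Proof. by move=> a b; rewrite /charmod_scale rmorphD; apply: mulrDl. Qed.
HB.instance Definition _ := GRing.Zmodule_isLmodule.Build A (charmod chi)
  charmod_scaleA charmod_scale1 charmod_scaleDr charmod_scaleDl.
End CharacterModule.

Section Coordinates.
Variables (K : fieldType) (A : falgType K) (n : nat) (rho : seq (nat * nat)).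
Hypothesis rels : path_relations n rho.
Variable C : coordinates A n rho.
Local Notation cf := (cf C).
Local Notation good := (nonzero_path n rho).
Local Notation first_zero := (first_zero n rho).
Local Notation stops := (stops n rho).

Lemma cfD x y a b : cf (x + y) a b = cf x a b + cf y a b.
Proof. by rewrite -{1}[x]scale1r cfP mul1r. Qed.

Lemma cf0 a b : cf 0 a b = 0.
Proof. by have := cfP C (-1) 0 0 a b; rewrite scaler0 add0r mulN1r addNr. Qed.

Lemma cfZ c x a b : cf (c *: x) a b = c * cf x a b.
Proof. by rewrite -{1}[c *: x]addr0 cfP cf0 addr0. Qed.

Lemma cfN x a b : cf (- x) a b = - cf x a b.
Proof. by rewrite -scaleN1r cfZ mulN1r. Qed.

Lemma cf_ext x y : (forall a b, good a b -> cf x a b = cf y a b) -> x = y.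
Proof. exact: cf_inj. Qed.

Lemma good_refl a : good a a = (0 < a <= n)%N.
Proof.
rewrite /nonzero_path leqnn /=; case: (0 < a)%N => //=.
have [an | na] := leqP a n; first by rewrite first_zero_gt //.
by apply/negbTE; rewrite -leqNgt (leq_trans _ na) // first_zero_le.
Qed.
Lemma good_split a b c :
  good a b -> (a <= c)%N -> (c <= b)%N -> good a c /\ good c b.
Proof.
move=> /and3P[a0 ab bn] ac cb; rewrite /nonzero_path a0 ac cb.
rewrite (leq_ltn_trans cb bn) (leq_trans a0 ac) /=.
by rewrite (leq_trans bn) // first_zero_mono //.
Qed.

Lemma good_le a b : good a b -> (b <= n)%N.
Proof. by case/and3P=> _ _ /leq_trans-/(_ _ (first_zero_le rels a)). Qed.

Definition table (g : nat -> nat -> K) : A := projT1 (cid (cf_surj C g)).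

Lemma tableE g a b : good a b -> cf (table g) a b = g a b.
Proof. exact: projT2 (cid (cf_surj C g)) a b. Qed.

(** The class in A of the path from a to b; it is 0 if that path is. *)
Definition path_in (a b : nat) : A :=
  table (fun c d => ((c == a) && (d == b))%:R).

Lemma cf_mul_path x a b c d : good c d -> (a <= b)%N ->
  cf (x * path_in a b) c d = if (c == a) && (b <= d)%N then cf x b d else 0.
Proof.
move=> gcd ab; rewrite cf_mul //; case: ifP => [/andP[/eqP ca bd] | neq].
  rewrite {c}ca in gcd *.
  rewrite (bigD1_seq b) ?iota_uniq ?mem_index_iota ?ab ?ltnS //=.
  rewrite tableE ?(good_split gcd ab bd).1 // !eqxx mulr1 big1_seq ?addr0 //.
  move=> e /andP[/negPf eb]; rewrite mem_index_iota ltnS => /andP[ae ed].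
  by rewrite tableE ?(good_split gcd ae ed).1 // eb andbF mulr0.
rewrite big1_seq // => e /=; rewrite mem_index_iota ltnS => /andP[ce ed].
rewrite tableE ?(good_split gcd ce ed).1 //.
case: eqP neq => [_ | _ _]; last by rewrite mulr0.
by case: eqP ed => [-> -> | _]; rewrite ?mulr0.
Qed.

Lemma cf_path_mul y a b c d : good c d -> (a <= b)%N ->
  cf (path_in a b * y) c d = if (d == b) && (c <= a)%N then cf y c a else 0.
Proof.
move=> gcd ab; rewrite cf_mul //; case: ifP => [/andP[/eqP db ca] | neq].
  rewrite {d}db in gcd *.
  rewrite (bigD1_seq a) ?iota_uniq ?mem_index_iota ?ca ?ltnS //=.
  rewrite tableE ?(good_split gcd ca ab).2 // !eqxx mul1r big1_seq ?addr0 //.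
  move=> e /andP[/negPf ea]; rewrite mem_index_iota ltnS => /andP[ce eb].
  by rewrite tableE ?(good_split gcd ce eb).2 // ea mul0r.
rewrite big1_seq // => e /=; rewrite mem_index_iota ltnS => /andP[ce ed].
rewrite tableE ?(good_split gcd ce ed).2 //.
case: (e =P a) ce => [-> ca | _ _]; last by rewrite mul0r.
by rewrite ca andbT in neq; rewrite neq mul0r.
Qed.

(** * Left ideals generated by paths and their syzygies *)

(** The left ideal generated by the path from a to b.  It is described by the
    support of its elements, the paths from a that pass through b, because this
    makes membership a condition on coordinates. *)
Definition ideal_pred (a b : nat) : {pred A^o} := fun x =>
  `[< forall c d, good c d -> ~~ ((c == a) && (b <= d)%N) -> cf x c d = 0 >].

Lemma ideal_predP a b (x : A) :
  reflect (forall c d, good c d -> ~~ ((c == a) && (b <= d)%N) -> cf x c d = 0)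
          (x \in ideal_pred a b).
Proof. exact: asboolP. Qed.

Fact ideal_closed a b : submod_closed (ideal_pred a b).
Proof.
split; first by apply/ideal_predP => c d _ _; rewrite cf0.
move=> r x y /ideal_predP x0 /ideal_predP y0; apply/ideal_predP => c d gcd neq.
rewrite cfD y0 // addr0 -[r *: x]/((r : A) * (x : A)) cf_mul //.
rewrite big1_seq // => e.
rewrite mem_index_iota ltnS => /andP[_ /andP[ce ed]].
rewrite x0 ?mulr0 // ?(good_split gcd ce ed).1 //.
by apply: contra neq => /andP[-> be]; apply: leq_trans ed.
Qed.

Definition path_ideal a b : lmodType A := submod (ideal_closed a b).

Definition ideal_val {a b} : {linear path_ideal a b -> A^o} := val.

(** Keeping the inclusion as a bare function gives equations in A that can be
    rewritten without going through the module structure of [A^o]. *)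
Definition elt {a b} (x : path_ideal a b) : A := ideal_val x.

Lemma ideal_val_inj {a b} : injective (@ideal_val a b).
Proof. exact: val_inj. Qed.

Lemma elt_ext a b (x y : path_ideal a b) :
  (forall c d, good c d -> cf (elt x) c d = cf (elt y) c d) -> x = y.
Proof. by move=> xy; apply: ideal_val_inj; apply: cf_ext. Qed.

Lemma eltZ a b (r : A) (x : path_ideal a b) : elt (r *: x) = r * elt x.
Proof. by rewrite /elt linearZ. Qed.

Lemma elt0 a b : elt (0 : path_ideal a b) = 0.
Proof. exact: linear0. Qed.

Lemma ideal_valP a b (x : A) :
  (exists k : path_ideal a b, elt k = x) <-> x \in ideal_pred a b.
Proof.
split=> [[k <-] | xP]; first exact: valP.
by exists (Sub (x : A^o) (xP : (x : A^o) \in submod_pred (ideal_closed a b))).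
Qed.

Lemma elt_eq0 a b c d (x : path_ideal a b) :
  good c d -> ~~ ((c == a) && (b <= d)%N) -> cf (elt x) c d = 0.
Proof. exact: (elimT (ideal_predP a b _) (valP x)). Qed.

Lemma ideal_factor a b (M : lmodType A) (g : {linear M -> A^o}) :
    (forall x, (g x : A) \in ideal_pred a b) ->
  exists h : {linear M -> path_ideal a b}, forall x, elt (h x) = g x.
Proof.
move=> gP.
have [x|h hE] := @factor_inj A _ M _ (@ideal_val a b) g ideal_val_inj.
  by have [k kE] := (@ideal_valP a b (g x)).2 (gP x); exists k.
by exists h.
Qed.

Lemma ideal_inclusion a b c : (b <= c)%N ->
  exists i : {linear path_ideal a c -> path_ideal a b},
    [/\ forall x, elt (i x) = elt x, injective i &
        forall x, (elt x : A) \in ideal_pred a c -> exists y, i y = x].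
Proof.
move=> bc; have [x|i iE] := @ideal_factor a b _ (@ideal_val a c).
  apply/ideal_predP => e d ged neq; rewrite -[ideal_val x]/(elt x) elt_eq0 //.
  by apply: contra neq => /andP[-> /(leq_trans bc)].
exists i; split=> // [x y /(congr1 elt) | x /ideal_valP[y yE]].
  by rewrite !iE; apply: ideal_val_inj.
by exists y; apply: ideal_val_inj; apply: (etrans (iE y)).
Qed.

Fact mulr_is_linear (u : A) : linear (fun x : A^o => (x : A) * u : A^o).
Proof. by move=> r x y; rewrite mulrDl -mulrA. Qed.
Definition mulr_lin (u : A) : {linear A^o -> A^o} :=
  lin_of (mulr_is_linear u).

Lemma path_ideal_map a b : (a <= b)%N ->
  exists p : {linear A^o -> path_ideal a b},
    forall x, elt (p x) = (x : A) * path_in a b.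
Proof.
move=> ab; apply: (ideal_factor (g := mulr_lin (path_in a b))) => x.
by apply/ideal_predP => c d gcd neq; rewrite cf_mul_path // (negPf neq).
Qed.

(** Right multiplication by the idempotent at b retracts A onto this ideal. *)
Lemma path_ideal_projective b : projective_module (path_ideal b b).
Proof.
have [t tE] := path_ideal_map (leqnn b).
apply: (@retract_projective A A^o _ (@ideal_val b b) t) => [x|].
  apply: elt_ext => c d gcd; rewrite tE cf_mul_path //.
  by case: ifP => [/andP[/eqP -> //] | neq]; rewrite elt_eq0 // neq.
move=> M N f g f_surj; have [m fm] := f_surj (g 1).
have lh : linear (fun x : A^o => (x : A) *: m).
  by move=> r x y; rewrite scalerDl scalerA.
exists (lin_of lh) => x /=; rewrite linearZ fm -linearZ; congr (g _).
exact: mulr1.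
Qed.

Lemma path_ideal_cover a b : good a b ->
  exists p : {linear path_ideal b b -> path_ideal a b},
    (forall x, elt (p x) = elt x * path_in a b) /\ forall y, exists x, p x = y.
Proof.
move=> gab; have /and3P[a0 ab bn] := gab.
have [q qE] := path_ideal_map ab.
exists (q \o ideal_val); split=> [x | y]; first exact: qE.
pose x := table (fun c d => if c == b then cf (elt y) a d else 0).
have [|x' x'E] := (@ideal_valP b b x).2.
  apply/ideal_predP => c d gcd; rewrite tableE //.
  by case: eqP => // cb; case/and3P: gcd => _; rewrite cb /= => ->.
exists x'; apply: elt_ext => c d gcd; rewrite qE -[ideal_val x']/(elt x') x'E.
rewrite cf_mul_path //; case: ifP => [/andP[/eqP ca bd] | neq]; last first.
  by rewrite elt_eq0 // neq.
rewrite ca in gcd *; have [_ gbd] := good_split gcd ab bd.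
by rewrite tableE // eqxx.
Qed.

(** Right multiplication by the path from a to b kills exactly the combinations
    of paths from b that reach [first_zero a]. *)
Lemma path_ideal_exact a b : good a b ->
  short_exact (path_ideal b (first_zero a)) (path_ideal b b) (path_ideal a b).
Proof.
move=> gab; have /and3P[a0 ab bn] := gab.
have [i [iE inj_i imi]] := ideal_inclusion b (ltnW bn).
have [p [pE p_surj]] := path_ideal_cover gab.
exists i, p; split=> // x; split=> [px | [k <-]].
  apply: imi; apply/ideal_predP => c d gcd neq.
  have [/andP[/eqP cb bd] | ] := boolP ((c == b) && (b <= d)%N); last first.
    exact: elt_eq0.
  rewrite cb in gcd neq *; have dn : (d < first_zero a)%N.
    by move: neq; rewrite eqxx -ltnNge.
  have gad : good a d by rewrite /nonzero_path a0 (leq_trans ab bd).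
  have := cf_mul_path (elt x) gad ab; rewrite eqxx bd /= => <-.
  by rewrite -pE px elt0 cf0.
apply: elt_ext => c d gcd; rewrite pE iE cf_mul_path // elt0 cf0.
case: ifP => // /andP[/eqP ca bd]; rewrite ca in gcd.
have [_ gbd] := good_split gcd ab bd; rewrite elt_eq0 //.
by case/and3P: gcd => _ _; rewrite eqxx -ltnNge.
Qed.

Lemma path_ideal_eq0 a b (x : path_ideal a b) : (first_zero a <= b)%N -> x = 0.
Proof.
move=> nb; apply: elt_ext => c d gcd.
rewrite elt0 cf0 elt_eq0 //; apply/negP => /andP[/eqP ca bd].
case/and3P: gcd => _ _; rewrite ca ltnNge => /negP; apply.
exact: leq_trans bd.
Qed.

Lemma path_in_ideal a b : (a <= b)%N ->
  exists k : path_ideal a b, elt k = path_in a b.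
Proof.
move=> ab; apply/ideal_valP/ideal_predP => c d gcd; rewrite tableE //.
by case: eqP => //= _; case: (d =P b) => // ->; rewrite leqnn.
Qed.

(** If the cover by [path_ideal b b] splits, the path from a to b is sent to some
    y with coefficient 1 at the trivial path at b.  The path z from b to
    [first_zero a] kills the path from a to b, but it cannot kill y unless z is
    itself zero, that is unless [first_zero b] is [first_zero a]. *)
Lemma path_ideal_projectiveP a b :
  good a b ->
  projective_module (path_ideal a b) <-> first_zero a = first_zero b.
Proof.
move=> gab; have /and3P[a0 ab bn] := gab.
split=> [prL | eqn]; last first.
  apply: (zero_kernel_projective (path_ideal_exact gab)) => [x|].
    by apply: path_ideal_eq0; rewrite eqn.
  exact: path_ideal_projective.
apply/eqP; rewrite eqn_leq first_zero_mono //= leqNgt; apply/negP => lt.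
have [p [pE p_surj]] := path_ideal_cover gab.
have [s sK] := section_exists prL p_surj.
have [u uE] := path_in_ideal ab.
pose y : A := elt (s u).
have y1 : cf y b b = 1.
  have := cf_mul_path y gab ab; rewrite eqxx leqnn /= => <-.
  by rewrite -pE sK uE tableE // !eqxx.
pose z := path_in b (first_zero a).
have gz : good b (first_zero a) by rewrite /nonzero_path (leq_trans a0 ab) ltnW.
suff : cf (z * y) b (first_zero a) = 0.
  by rewrite cf_path_mul ?(ltnW bn) // eqxx leqnn y1 => /eqP; rewrite oner_eq0.
suff zu : z *: u = 0 by rewrite -eltZ -linearZ zu linear0 elt0 cf0.
apply: elt_ext => c d gcd; rewrite eltZ uE cf_mul_path // elt0 cf0.
case: ifP => // /andP[/eqP ca bd]; rewrite ca in gcd.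
have [_ gbd] := good_split gcd ab bd; rewrite tableE // eqxx /=.
by case: eqP gcd => // -> /and3P[_ _]; rewrite ltnn.
Qed.

(** The syzygy of the ideal for the pair (a, b) is the ideal for the pair
    (b, first_zero a), just as in the recursion of [stops]. *)
Lemma pd_le_path_ideal m a b :
  good a b -> pd_le m (path_ideal a b) <-> stops m a b.
Proof.
elim: m a b => [|m IHm] a b gab.
  by rewrite /= orbF path_ideal_projectiveP //; split=> /eqP.
have /and3P[a0 ab bn] := gab.
case: (ltngtP (first_zero a) (first_zero b)) (first_zero_mono rels ab) => //
  [lt _ | eqn _].
  have gb : good b (first_zero a).
    by rewrite /nonzero_path (leq_trans a0 ab) ltnW.
  rewrite (pd_le_kernel m (path_ideal_exact gab)); last first.
    exact: path_ideal_projective.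
  by rewrite IHm //= ltn_eqF.
split=> _; first by rewrite /= eqn eqxx.
by apply: (@pd_leW _ 0) => //; apply/path_ideal_projectiveP.
Qed.

Fact chi_zmod a : zmod_morphism (fun x => cf x a a).
Proof. by move=> x y; rewrite cfD cfN. Qed.

Fact chi_monoid a : (0 < a <= n)%N -> monoid_morphism (fun x => cf x a a).
Proof.
rewrite -good_refl => ga; split; first by rewrite cf_one // eqxx.
by move=> x y; rewrite cf_mul // big_nat1.
Qed.

Definition chi a (an : (0 < a <= n)%N) : {rmorphism A -> K} :=
  HB.pack (fun x => cf x a a)
    (GRing.isZmodMorphism.Build A K _ (chi_zmod a))
    (GRing.isMonoidMorphism.Build A K _ (chi_monoid an)).

Definition simple_at a an : lmodType A := charmod (@chi a an).

Lemma simple_at_scale a an (x : A) (v : @simple_at a an) :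
  x *: v = cf x a a * (v : K) :> K.
Proof. by []. Qed.

Lemma simple_at_cover a an :
  exists p : {linear path_ideal a a -> @simple_at a an},
    (forall x, p x = cf (elt x) a a :> K) /\ forall y, exists x, p x = y.
Proof.
have ga : good a a by rewrite good_refl.
have lp : linear (fun x : path_ideal a a => cf (elt x) a a : simple_at an).
  move=> r x y; rewrite /elt linearP cfD; congr (_ + _).
  by rewrite -[_ *: _]/(r * elt x) cf_mul // big_nat1.
exists (lin_of lp); split=> // v.
have [u uE] := path_in_ideal (leqnn a).
exists ((v : K)%:A *: u) => /=.
by rewrite eltZ uE mulr_algl cfZ tableE // !eqxx mulr1.
Qed.

Lemma simple_at_exact a an :
  short_exact (path_ideal a a.+1) (path_ideal a a) (@simple_at a an).
Proof.
have [p [pE p_surj]] := simple_at_cover an.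
have [i [iE inj_i imi]] := ideal_inclusion a (leqnSn a).
have ga : good a a by rewrite good_refl.
exists i, p; split=> // x; split=> [px | [k <-]].
  apply: imi; apply/ideal_predP => c d gcd neq.
  have [/andP[/eqP ca ad] | ] := boolP ((c == a) && (a <= d)%N); last first.
    exact: elt_eq0.
  have da : d = a.
    by apply/eqP; rewrite eqn_leq ad andbT leqNgt; move: neq; rewrite ca eqxx.
  by rewrite ca da -pE px.
by rewrite [LHS]pE iE elt_eq0 // eqxx ltnn.
Qed.

(** As for path ideals, with the arrow a -> a + 1 in the role of z; this arrow is
    nonzero because relations have length at least 2. *)
Lemma simple_at_projectiveP a an :
  projective_module (@simple_at a an) <-> a = n.
Proof.
have ga : good a a by rewrite good_refl.
have /andP[a0 a_n] := an.
split=> [prS | an']; last first.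
  apply: (zero_kernel_projective (simple_at_exact an)) => [x|].
    by apply: path_ideal_eq0; rewrite an' first_zero_le.
  exact: path_ideal_projective.
apply/eqP; rewrite eqn_leq a_n leqNgt; apply/negP => lt.
have [p [pE p_surj]] := simple_at_cover an.
have [s sK] := section_exists prS p_surj.
pose v : simple_at an := (1 : K).
pose y : A := elt (s v).
have y1 : cf y a a = 1 by rewrite -pE sK.
have gz : good a a.+1 by rewrite /nonzero_path a0 leqnSn first_zero_gt2.
pose z := path_in a a.+1.
suff : cf (z * y) a a.+1 = 0.
  by rewrite cf_path_mul // eqxx leqnn y1 => /eqP; rewrite oner_eq0.
suff zu : z *: v = 0 by rewrite -eltZ -linearZ zu linear0 elt0 cf0.
by rewrite [LHS]simple_at_scale tableE // eqxx (ltn_eqF (ltnSn a)) mul0r.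
Qed.

Lemma pd_le_simple_at m a an :
  pd_le m.+1 (@simple_at a an) <-> ((a < n)%N ==> stops m a a.+1).
Proof.
have /andP[a0 a_n] := an.
have [lt | ge] := ltnP a n; rewrite ?implyTb ?implyFb.
  rewrite (pd_le_kernel m (simple_at_exact an)); last first.
    exact: path_ideal_projective.
  by apply: pd_le_path_ideal; rewrite /nonzero_path a0 leqnSn first_zero_gt2.
split=> // _; apply: (@pd_leW _ 0) => //; apply/simple_at_projectiveP.
by apply/eqP; rewrite eqn_leq a_n.
Qed.

End Coordinates.
(** * Finite dimensional modules *)
Section LinearAlgebra.
Variable K : fieldType.

Definition spanned (N : nat) (V : lmodType K) : Prop :=
  exists v : 'I_N -> V, forall x, exists c : 'I_N -> K, x = \sum_i c i *: v i.

Lemma spanned_dependent N (V : lmodType K) (v : 'I_N.+1 -> V)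
    (d : 'I_N.+1 -> K) j :
    (forall x, exists c : 'I_N.+1 -> K, x = \sum_i c i *: v i) ->
  \sum_i d i *: v i = 0 -> d j != 0 -> spanned N V.
Proof.
move=> v_span d0 dj; exists (fun i => v (lift j i)) => x.
have [c ->] := v_span x.
exists (fun i => c (lift j i) - c j / d j * d (lift j i)).
transitivity (\sum_i (c i - c j / d j * d i) *: v i); last first.
  by rewrite (bigD1_ord j) //= divfK // subrr scale0r add0r.
under [RHS]eq_bigr do rewrite scalerBl -scalerA.
by rewrite sumrB -scaler_sumr d0 scaler0 subr0.
Qed.

(** A spanning family of minimal size is free, so its coordinate functions are
    linear. *)
Lemma functional_exists N (V : lmodType K) (y : V) :
  spanned N V -> y != 0 -> exists phi : {linear V -> K^o}, phi y != 0.
Proof.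
move=> Nspan y0.
have exN : exists k, `[< spanned k V >] by exists N; apply/asboolP.
case: (ex_minnP exN) => {N Nspan exN}N.
move=> /asboolP[v /[dup] v_span /choice[c cE]] Nmin.
have free d j : \sum_i d i *: v i = 0 -> d j = 0.
  move=> d0; apply/eqP; apply: contraT => dj.
  case: N v v_span c cE Nmin d d0 j dj => [|N] v v_span c cE Nmin d d0 j dj.
    by case: j dj.
  have /Nmin : `[< spanned N V >].
    by apply/asboolP; apply: spanned_dependent v_span d0 dj.
  by rewrite ltnn.
have lin j : linear (fun x => c x j : K^o).
  move=> a x z; apply/eqP; rewrite -subr_eq0; apply/eqP.
  apply: (free (fun i => c (a *: x + z) i - (a * c x i + c z i)) j).
  under eq_bigr do rewrite scalerBl scalerDl -scalerA.
  by rewrite sumrB big_split /= -scaler_sumr -!cE subrr.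
have [j cj] : exists j, c y j != 0.
  apply/existsP; apply: contra_neqT y0 => /existsPn c0.
  rewrite (cE y) big1 // => i _; have := c0 i.
  by rewrite negbK => /eqP->; rewrite scale0r.
by exists (lin_of (lin j)).
Qed.

(** One step of elimination: a vector v_j with phi v_j != 0 is used as a pivot to
    move the other spanning vectors into the kernel. *)
Lemma spanned_kernel N (V U : lmodType K) (phi : {linear V -> K^o})
    (i : {linear U -> V}) :
    spanned N.+1 V -> injective i ->
    (forall x, phi x = 0 -> exists u, i u = x) ->
    (forall u, phi (i u) = 0) -> (exists x, phi x != 0) ->
  spanned N U.
Proof.
move=> [v v_span] inj_i keri phii [x phix].
have [j vj] : exists j, phi (v j) != 0.
  apply/existsP; apply: contraNT phix => /existsPn v0.
  have [c ->] := v_span x; rewrite linear_sum big1 // => k _.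
  by have := v0 k; rewrite linearZ negbK => /eqP->; apply: mulr0.
have /choice[w wE] l : exists u,
    i u = v (lift j l) - (phi (v (lift j l)) / phi (v j)) *: v j.
  apply: keri; rewrite linearB linearZ /=.
  by rewrite -[_ *: _]/(_ * _) divfK // subrr.
exists w => u; have [c cE] := v_span (i u).
exists (fun l => c (lift j l)); apply: inj_i; rewrite linear_sum /=.
under eq_bigr do rewrite linearZ /= wE scalerBr scalerA mulrA.
rewrite sumrB -scaler_suml -mulr_suml.
have : phi (i u) = 0 by [].
rewrite {1}cE linear_sum (bigD1_ord j) //= linearZ /=.
under eq_bigr do rewrite linearZ.
move/eqP; rewrite addrC addr_eq0 => /eqP ->; rewrite mulNr.
rewrite -[c j *: phi (v j)]/(c j * phi (v j)) mulfK // scaleNr opprK.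
by rewrite addrC [LHS]cE (bigD1_ord j).
Qed.

End LinearAlgebra.

Section FiniteDimensional.
Variables (K : fieldType) (A : falgType K).

(** The vector space underlying an A-module.  It needs a name of its own to carry
    a second scalar multiplication. *)
Definition kmod (M : lmodType A) : Type := M.
Section KMod.
Variable M : lmodType A.
HB.instance Definition _ := GRing.Zmodule.copy (kmod M) M.
Definition kscale (c : K) (x : kmod M) : kmod M := (c%:A : A) *: (x : M).
Fact kscaleA a b v : kscale a (kscale b v) = kscale (a * b) v.
Proof. by rewrite /kscale scalerA -scalerAl mul1r scalerA. Qed.
Fact kscale1 : left_id 1 kscale.
Proof. by move=> v; rewrite /kscale !scale1r. Qed.
Fact kscaleDr : right_distributive kscale +%R.
Proof. by move=> a u v; apply: scalerDr. Qed.
Fact kscaleDl v : {morph kscale^~ v : a b / a + b}.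
Proof. by move=> a b; rewrite /kscale scalerDl; apply: scalerDl. Qed.
HB.instance Definition _ := GRing.Zmodule_isLmodule.Build K (kmod M)
  kscaleA kscale1 kscaleDr kscaleDl.
End KMod.

Lemma finite_dim_spanned (M : lmodType A) :
  finite_dim_module M -> exists N, spanned N (kmod M : lmodType K).
Proof.
by move=> [s sE]; exists (size s), (fun i => s`_i : kmod M) => x; apply: sE.
Qed.

Lemma kmod_linear (M N : lmodType A) (f : {linear M -> N}) :
  linear (f : kmod M -> kmod N).
Proof. by move=> c x y; apply: (linearP f). Qed.

End FiniteDimensional.
Section Modules.
Variables (K : fieldType) (A : falgType K) (n : nat) (rho : seq (nat * nat)).
Hypothesis rels : path_relations n rho.
Variable C : coordinates A n rho.
Local Notation cf := (cf C).
Local Notation good := (nonzero_path n rho).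
Local Notation path_in := (path_in C).
Local Notation simple_at := (simple_at rels C).

Lemma cf_sum I (r : seq I) (F : I -> A) a b :
  cf (\sum_(i <- r) F i) a b = \sum_(i <- r) cf (F i) a b.
Proof.
by elim: r => [|i r IHr]; rewrite ?big_nil ?cf0 // !big_cons cfD IHr.
Qed.

Lemma idem_mul a r : path_in a a * r =
  \sum_(1 <= c < a.+1) cf r c a *: (path_in c a * path_in c c).
Proof.
apply: (cf_ext (C := C)) => c d gcd; rewrite cf_path_mul // cf_sum.
have /and3P[c0 cd _] := gcd; case: ifP => [/andP[/eqP da ca] | neq].
  rewrite {d}da in gcd cd *.
  rewrite (bigD1_seq c) ?iota_uniq ?mem_index_iota ?c0 ?ltnS //=.
  rewrite cfZ cf_mul_path // eqxx cd tableE // !eqxx mulr1.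
  rewrite big1_seq ?addr0 // => e /andP[/negPf ec _].
  by rewrite cfZ cf_mul_path // eq_sym ec mulr0.
rewrite big1_seq // => e; rewrite mem_index_iota ltnS => /andP[_ /andP[_ ea]].
rewrite cfZ cf_mul_path //; case: ifP; last by rewrite mulr0.
move=> /andP[/eqP ce ed].
rewrite ce in gcd neq; rewrite tableE // eqxx /=.
by case: eqP neq => [_ | _ _]; rewrite ?mulr0 // ea.
Qed.

Lemma mul_idem a r : r * path_in a a =
  \sum_(a <= c < n.+1) cf r a c *: (path_in c c * path_in a c).
Proof.
apply: (cf_ext (C := C)) => c d gcd; rewrite cf_mul_path // cf_sum.
have /and3P[c0 cd _] := gcd; case: ifP => [/andP[/eqP ca ad] | neq].
  rewrite {c}ca in gcd cd c0 *.
  have dn := good_le rels gcd.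
  rewrite (bigD1_seq d) ?iota_uniq ?mem_index_iota ?ad ?ltnS ?dn //=.
  rewrite cfZ cf_path_mul // eqxx ad tableE // !eqxx mulr1.
  rewrite big1_seq ?addr0 // => e /andP[/negPf ed _].
  by rewrite cfZ cf_path_mul // eq_sym ed mulr0.
rewrite big1_seq // => e; rewrite mem_index_iota ltnS => /andP[_ /andP[ae _]].
rewrite cfZ cf_path_mul //; case: ifP; last by rewrite mulr0.
move=> /andP[/eqP de ce].
rewrite de in gcd neq; rewrite tableE // eqxx andbT.
by case: eqP neq => [_ | _ _]; rewrite ?mulr0 // ae.
Qed.

Lemma one_sum : 1 = \sum_(1 <= a < n.+1) path_in a a.
Proof.
apply: (cf_ext (C := C)) => c d gcd; rewrite cf_one // cf_sum.
have /and3P[c0 cd _] := gcd.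
rewrite (bigD1_seq c) ?iota_uniq ?mem_index_iota ?c0 ?ltnS //=; last first.
  by rewrite (leq_trans cd) ?(good_le rels gcd).
rewrite tableE // eqxx eq_sym big1_seq ?addr0 // => e /andP[/negPf ec _].
by rewrite tableE // eq_sym ec.
Qed.

Lemma idem_neq0 (M : lmodType A) (x : M) :
  x != 0 -> exists a, (0 < a <= n)%N && (path_in a a *: x != 0).
Proof.
apply: contra_neqP => H; rewrite -[x]scale1r one_sum scaler_suml.
rewrite big1_seq // => a; rewrite mem_index_iota ltnS => /andP[_ an].
by apply/eqP; apply: contraT => ax; case: H; exists a; rewrite an.
Qed.

Lemma path_mul_refl a b : (a <= b)%N -> path_in a b * path_in a a = path_in a b.
Proof.
move=> ab; apply: (cf_ext (C := C)) => c d gcd.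
rewrite cf_mul_path // [RHS]tableE //.
case: (c =P a) gcd => [-> gad | _ _] /=; last by [].
have /and3P[a0 -> _] := gad.
by rewrite tableE // eqxx.
Qed.

Lemma path_refl_mul a b : (a <= b)%N -> path_in b b * path_in a b = path_in a b.
Proof.
move=> ab; apply: (cf_ext (C := C)) => c d gcd.
rewrite cf_path_mul // [RHS]tableE //.
case: (d =P b) gcd => [-> gcb | _ _]; last by rewrite andbF.
by have /and3P[_ -> _] := gcb; rewrite tableE // eqxx.
Qed.

Lemma scaler_alg (M : lmodType A) (k : K) (u : A) (z : M) :
  (k *: u) *: z = k%:A *: (u *: z).
Proof. by rewrite scalerA mulr_algl. Qed.

(** Let a be the least vertex with e_a M != 0.  Nonzero paths ending at a start at
    vertices c <= a, and only the trivial one acts on M, so A acts on e_a M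
    through the character of S_a.  Hence any functional on e_a M, composed with
    the action of e_a, is A-linear. *)
Lemma simple_quotient (M : lmodType A) N (x : M) : x != 0 ->
  spanned N (kmod M : lmodType K) ->
  exists a an (f : {linear M -> @simple_at a an}), exists y, f y != 0.
Proof.
move=> x0 Mspan.
pose P a := (0 < a <= n)%N && `[< exists y : M, path_in a a *: y != 0 >].
have exP : exists a, P a.
  have [a /andP[an ax]] := idem_neq0 x0; exists a; rewrite /P an.
  by apply/asboolP; exists x.
case: (ex_minnP exP) => a /andP[an /asboolP[y ay]] amin.
have kill c (z : M) : (0 < c < a)%N -> path_in c c *: z = 0.
  move=> /andP[c0 ca]; apply/eqP; apply: contraT => cz.
  have /amin : P c; last by rewrite leqNgt ca.
  rewrite /P c0 (leq_trans (ltnW ca)) ?(andP an).2 //=.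
  by apply/asboolP; exists z.
have aM r (z : M) :
    path_in a a *: (r *: z) = (cf r a a)%:A *: (path_in a a *: z).
  rewrite scalerA idem_mul big_nat_recr ?(andP an).1 //= scalerDl scaler_suml.
  rewrite big1_seq ?add0r => [|c /andP[_]]; last first.
    rewrite mem_index_iota => ca.
    by rewrite scaler_alg -scalerA kill // !scaler0.
  by rewrite path_mul_refl // scaler_alg.
have [phi phiy] := @functional_exists K N (kmod M) (path_in a a *: y) Mspan ay.
have phiZ c (z : M) : phi ((c%:A : A) *: z) = c * phi z.
  by rewrite -[_ *: z]/(c *: (z : kmod M)) linearZ.
have lf : linear (fun z : M => (phi (path_in a a *: z) : K) : simple_at an).
  move=> r u v; rewrite scalerDr linearD; congr (_ + _).
  by rewrite aM phiZ.
by exists a, an, (lin_of lf), y.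
Qed.

Lemma simple_at_scalar a an (c : K) (v : @simple_at a an) :
  c%:A *: v = c * (v : K) :> K.
Proof. by rewrite [LHS]simple_at_scale cfZ cf_one ?good_refl // eqxx mulr1. Qed.

(** Induction on the size of a spanning family: split off a simple quotient and
    apply the horseshoe lemma. *)
Lemma pd_le_finite_dim m : (forall a an, pd_le m (@simple_at a an)) ->
  forall M : lmodType A, finite_dim_module M -> pd_le m M.
Proof.
move=> pdS M /finite_dim_spanned[N]; elim: N M => [|N IHN] M Mspan.
  apply: (@pd_leW _ 0) => //; apply: zero_projective => x.
  have [v v_span] := Mspan; have [c ->] := v_span x.
  by rewrite big_ord0.
have [M0 | /existsNP[x x0]] := pselect (forall x : M, x = 0).
  by apply: (@pd_leW _ 0) => //; apply: zero_projective.
have [a [an [f [y fy]]]] := simple_quotient (introN eqP x0) Mspan.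
have [U [i [inj_i kerf]]] := kernel_exists f.
apply: (@pd_le_extension _ m U M (simple_at an)) => //.
  exists i, f; split=> // v; exists ((v / f y : K)%:A *: y).
  by rewrite linearZ /= [LHS]simple_at_scalar divfK.
apply: IHN.
have lf : linear (fun x : kmod M => (f x : K) : K^o).
  by move=> c u v; rewrite linearP; congr (_ + _); apply: simple_at_scalar.
apply: (@spanned_kernel K N (kmod M) (kmod U) (lin_of lf)
         (lin_of (kmod_linear i))) => //.
- by move=> u /= /kerf.
- by move=> u /=; apply/kerf; exists u.
- by exists y.
Qed.

Lemma simple_at_finite_dim a an : finite_dim_module (@simple_at a an).
Proof.
exists [:: (1 : K) : simple_at an] => x; exists (fun _ => x : K).
by rewrite big_ord1 [RHS]simple_at_scalar mulr1.
Qed.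

Lemma simple_at_simple a an : simple_module (@simple_at a an).
Proof.
split; first by exists (1 : K); apply/eqP/oner_neq0.
move=> S [S0 SP].
have [[x [Sx x0]] | nS] := pselect (exists x, x \in S /\ x != 0).
  right=> y; rewrite inE.
  have := SP ((y : K) / (x : K))%:A x 0 Sx S0; rewrite addr0.
  suff -> : ((y : K) / (x : K))%:A *: x = y by [].
  by rewrite [LHS]simple_at_scalar divfK.
left=> y; rewrite inE; apply/idP/eqP => [Sy | -> //].
by apply/eqP; apply: contraT => y0; case: nS; exists y.
Qed.

(** Dually to [simple_quotient], let a be the greatest vertex with e_a M != 0.
    Every y in e_a M is then an eigenvector for the character of S_a, and a
    nonzero one generates M. *)
Lemma simple_moduleP (M : lmodType A) : simple_module M ->
  exists a an, module_iso (@simple_at a an) M.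
Proof.
move=> [[x /eqP x0] simM].
pose P a := (0 < a <= n)%N && `[< exists y : M, path_in a a *: y != 0 >].
have exP : exists a, P a.
  have [a /andP[an ax]] := idem_neq0 x0; exists a; rewrite /P an.
  by apply/asboolP; exists x.
have leP a : P a -> (a <= n)%N by case/andP=> /andP[].
case: (ex_maxnP exP leP) => a /andP[an /asboolP[z]].
set y := path_in a a *: z => y0 amax; exists a, an.
have kill c (u : M) : (a < c <= n)%N -> path_in c c *: u = 0.
  move=> /andP[ac cn]; apply/eqP; apply: contraT => cu.
  have /amax : P c; last by rewrite leqNgt ac.
  rewrite /P cn (leq_ltn_trans (leq0n a) ac) /=.
  by apply/asboolP; exists u.
have yZ r : r *: y = (cf r a a)%:A *: y.
  rewrite scalerA mul_idem big_ltn ?ltnS ?(andP an).2 //=.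
  rewrite scalerDl scaler_suml.
  rewrite big1_seq ?addr0 => [|c /andP[_]]; last first.
    rewrite mem_index_iota ltnS => ca.
    by rewrite scaler_alg -scalerA kill // !scaler0.
  by rewrite path_refl_mul // scaler_alg.
clearbody y.
have lf : linear (fun v : simple_at an => ((v : K)%:A : A) *: y).
  move=> r u v; rewrite scalerDl scalerDl; congr (_ + _).
  rewrite [RHS]scalerA mulr_algr [RHS]yZ cfZ; congr (_%:A *: _).
  by rewrite mulrC.
pose f := lin_of lf; exists f.
have inj_f : injective f.
  move=> u v /eqP; rewrite -subr_eq0 -linearB => uv; apply/eqP.
  rewrite -subr_eq0; apply: contraT => uv0.
  have /eqP : (((u - v : simple_at an) : K)^-1%:A : A) *: f (u - v) = 0.
    by rewrite (eqP uv) scaler0.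
  rewrite /= scalerA mulr_algl scalerA mulVf // scale1r scale1r.
  by rewrite (negPf y0).
pose T : {pred M} := fun u => `[< exists v, f v = u >].
have clT : submod_closed T.
  split; first by apply/asboolP; exists 0; rewrite linear0.
  move=> r _ _ /asboolP[u <-] /asboolP[v <-].
  by apply/asboolP; exists (r *: u + v); rewrite linearP.
have [T0 | T1] := simM T clT.
  have : y \in T.
    by apply/asboolP; exists (1 : K); rewrite /= scale1r scale1r.
  by rewrite T0 inE (negPf y0).
have /choice[g gE] u : exists v, f v = u by apply/asboolP; apply: (T1 u).
by exists g => // u; apply: inj_f; rewrite gE.
Qed.

Lemma simple_at_inj a an b bn :
  module_iso (@simple_at a an) (@simple_at b bn) -> a = b.
Proof.
move=> [f [g fK gK]]; apply/eqP; apply: contraT => ab.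
pose u : simple_at an := (1 : K).
have ga : good a a by rewrite good_refl.
have gb : good b b by rewrite good_refl.
have uE : path_in a a *: u = u.
  by rewrite [LHS]simple_at_scale tableE // eqxx mulr1.
have fu : f u = 0.
  rewrite -uE linearZ /= [LHS]simple_at_scale tableE //.
  by rewrite eq_sym (negPf ab) mul0r.
by move/eqP: (fK u); rewrite fu -[0](linear0 f) fK eq_sym oner_eq0.
Qed.

End Modules.
(** * Global dimension and number of relations *)
Section Dimensions.
Variables (K : fieldType) (A : falgType K) (n : nat) (rho : seq (nat * nat)).
Hypothesis rels : path_relations n rho.
Variable C : coordinates A n rho.
Local Notation simple_at := (simple_at rels C).

Lemma has_pdim1P (M : lmodType A) :
  has_pdim M 1 <-> pd_le 1 M /\ ~ projective_module M.
Proof.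
split=> [[/pdim_leP pd1 min1] | [pd1 nprM]].
  by split=> // prM; have /min1 : pdim_le M 0 by apply/pdim_leP.
split; first exact/pdim_leP.
by case=> // /pdim_leP.
Qed.

(** The last vertex n belongs to the formal relation: S_n is projective. *)
Definition non_pd1_vertices := rcons [seq k.1 | k <- rho] n.

(** For a < n the radical of the projective cover of S_a is generated by the
    arrow at a.  It is projective if and only if f a = f (a + 1), that is if no
    relation starts at a. *)
Lemma simple_at_pdim1 a an :
  has_pdim (@simple_at a an) 1 <-> a \notin non_pd1_vertices.
Proof.
rewrite has_pdim1P pd_le_simple_at simple_at_projectiveP.
rewrite mem_rcons inE negb_or -(rel_index_stepP rels) -leqNgt /= orbF.
have /andP[a0 a_n] := an.
rewrite (first_zero_eq rels) eqn_leq rel_index_mono //= ltn_neqAle a_n andbT.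
case: eqP => /= [e | ne]; split=> //; first by case=> _ /(_ e).
by case.
Qed.

Lemma uniq_non_pd1_vertices : uniq non_pd1_vertices.
Proof.
rewrite rcons_uniq (sorted_uniq ltn_trans ltnn (sorted1 rels)) andbT.
apply/mapP => -[k kr nE]; have [_ k12 k2n] := rho_bound rels kr.
by move: (ltn_trans k12 k2n); rewrite -nE ltnn.
Qed.

Lemma module_iso_trans (M N P : lmodType A) :
  module_iso M N -> module_iso N P -> module_iso M P.
Proof.
by move=> [f bij_f] [g bij_g]; exists (g \o f); apply: bij_comp.
Qed.

Lemma lambda1_size r : has_lambda1 A r -> (0 < n)%N -> r = (size rho).+1.
Proof.
move=> [S [S_simple S_inj S_all]] n0.
have /choice[g gP] i : exists a,
    a \in non_pd1_vertices /\ exists an, module_iso (@simple_at a an) (S i).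
  have [simS npd] := S_simple i.
  have [a [an iso]] := simple_moduleP rels C simS.
  exists a; split; last by exists an.
  apply: contraT => /(simple_at_pdim1 an)/has_pdim1P[pd1 npr]; case: npd.
  apply/has_pdim1P; split; first exact: pd_le_iso iso pd1.
  by move=> prS; apply: npr; apply: (pd_le_iso (m := 0) (module_iso_sym iso)).
have g_inj : injective g.
  move=> i j gij; have [_ [ai isoi]] := gP i; have [_ [aj isoj]] := gP j.
  apply: S_inj; move: ai isoi; rewrite gij => ai isoi.
  rewrite (bool_irrelevance ai aj) in isoi.
  exact: module_iso_trans (module_iso_sym isoi) isoj.
have verts a : a \in non_pd1_vertices -> (0 < a <= n)%N.
  rewrite mem_rcons inE => /predU1P[-> | /mapP[k kr ->]].
    by rewrite n0 leqnn.
  have [k0 k12 k2n] := rho_bound rels kr.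
  by rewrite k0 ltnW // (ltn_trans k12).
have : perm_eq [seq g i | i <- enum 'I_r] non_pd1_vertices.
  apply: uniq_perm; first by rewrite map_inj_uniq ?enum_uniq.
    exact: uniq_non_pd1_vertices.
  move=> a; apply/mapP/idP => [[i _ ->] | aL]; first by have [] := gP i.
  have an := verts a aL.
  have [|i iso] := S_all (simple_at an) (simple_at_simple rels C an).
    by move/simple_at_pdim1; rewrite aL.
  exists i; rewrite ?mem_enum //.
  have [_ [bn iso']] := gP i.
  exact: simple_at_inj (module_iso_trans iso (module_iso_sym iso')).
by move/perm_size; rewrite size_map size_enum_ord size_rcons size_map.
Qed.

Lemma pd_le_size a an : pd_le (size rho).+1 (@simple_at a an).
Proof. by apply/pd_le_simple_at/implyP => lt; apply: stops_size. Qed.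

Lemma has_gldim_size :
  has_gldim A (size rho).+1 <->
  exists a an, ~ pd_le (size rho) (@simple_at a an).
Proof.
split=> [[_ min] | [a [an npd]]].
  apply: contrapT => H; suff /min : forall M : lmodType A,
    finite_dim_module M -> pdim_le M (size rho) by rewrite ltnn.
  move=> M Mfd; apply/pdim_leP; apply: (pd_le_finite_dim (C := C)) => // a an.
  by apply: contrapT => npd; apply: H; exists a, an.
split=> [M Mfd | m pdm].
  by apply/pdim_leP; apply: (pd_le_finite_dim pd_le_size).
rewrite ltnNge; apply/negP => ms; apply: npd; apply: pd_leW ms _.
by apply/pdim_leP/pdm/simple_at_finite_dim.
Qed.

Lemma has_gldim_chain : (1 < n)%N ->
  has_gldim A (size rho).+1 <-> forms_chain rho.
Proof.
move=> n1; rewrite has_gldim_size (chain_growsP rels) //; split.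
  move=> [a [an npd]]; exists a; have /andP[a0 a_n] := an.
  have lt : (a < n)%N.
    rewrite ltn_neqAle a_n andbT; apply/eqP => aE; apply: npd.
    by apply: (@pd_leW _ 0) => //; apply/simple_at_projectiveP.
  split=> //; case: (size rho) npd => // s npd.
  by apply/negP => st; apply: npd; apply/pd_le_simple_at/implyP.
move=> [a [a0 lt gr]]; have an : (0 < a <= n)%N by rewrite a0 ltnW.
exists a, an; case: (size rho) gr => [_ | s gr].
  by move=> /simple_at_projectiveP aE; rewrite aE ltnn in lt.
by move/pd_le_simple_at; rewrite lt (negPf gr).
Qed.

(** With a single vertex, A is K: a nonzero element is a nonzero scalar. *)
Lemma semisimple_n1 : (n <= 1)%N -> semisimple_ring A.
Proof.
move=> n1 S [S0 SP].
have scal (x : A) : x = (cf C x 1 1)%:A.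
  apply: (cf_ext (C := C)) => a b gab; have bn := good_le rels gab.
  have /and3P[a0 ab _] := gab; have b1 : b = 1%N.
    by apply/eqP; rewrite eqn_leq (leq_trans bn) // (leq_trans a0).
  have a1 : a = 1%N by apply/eqP; rewrite eqn_leq a0 -{1}b1 ab.
  rewrite a1 b1 in gab *; rewrite cfZ cf_one // eqxx mulr1 //.
have [S1 | nS1] := boolP ((1 : A^o) \in S).
  exists (pred1 (0 : A^o) : {pred A^o}); last first.
    split=> [x _ /eqP // | x]; exists x, 0; split; rewrite ?inE ?addr0 //.
    by have := SP x 1 0 S1 S0; rewrite addr0 -[x *: 1]/(x * 1) mulr1.
  split; first by rewrite inE.
  by move=> r x y; rewrite !inE => /eqP -> /eqP ->; rewrite scaler0 addr0.
exists (predT : {pred A^o}); first by [].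
split=> [x Sx _ | x]; last by exists 0, x; rewrite add0r.
apply/eqP; apply: contraT => x0; case/negP: nS1.
pose c := cf C x 1 1.
have c0 : c != 0.
  by apply: contraNneq x0 => c0; rewrite (scal x) -/c c0 scale0r.
have := SP (c^-1%:A) x 0 Sx S0; rewrite addr0.
suff -> : (c^-1%:A : A) *: x = 1 by [].
by rewrite (scal x) -/c [LHS]mulr_algl scalerA mulVf // scale1r.
Qed.

End Dimensions.
(** * Coordinates of a bound quiver algebra *)
Section BoundQuiver.
Variables (K : fieldType) (n : nat) (rho : seq (nat * nat)).
Hypothesis rels : path_relations n rho.
Local Notation KQ := (path_alg K n).
Local Notation good := (nonzero_path n rho).

Lemma pcoefZ c (x : KQ) a b : pcoef (c *: x) a b = c * pcoef x a b.
Proof. by rewrite /pcoef; case: insubP => [p|] _ /=; rewrite ?ffunE ?mulr0. Qed.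

Lemma pcoef0 a b : pcoef (0 : KQ) a b = 0.
Proof. by rewrite /pcoef; case: insubP => [p|] _ //=; rewrite ffunE. Qed.

Lemma pcoef_elt c d (a b : 'I_n.+1) :
  pcoef (path_elt K n c d) a b =
  [&& 0 < a, a <= b, a == c :> nat & b == d :> nat]%N%:R.
Proof.
have [ab | ab] := boolP ((0 < a)%N && (a <= b)%N).
  by rewrite /pcoef insubT /= ffunE; have /andP[-> ->] := ab.
by rewrite pcoef_eq0 // andbA (negPf ab).
Qed.

Lemma pcoef_ext (x y : KQ) : (forall a b, pcoef x a b = pcoef y a b) -> x = y.
Proof. by move=> xy; apply/ffunP => p; rewrite !pcoefE. Qed.

Lemma path_elt_mul (a b c : nat) : (0 < a)%N -> (a <= b)%N -> (b <= c)%N ->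
  (c <= n)%N ->
  path_elt K n b c * path_elt K n a b = path_elt K n a c.
Proof.
move=> a0 ab bc cn; apply: pcoef_ext => u v.
rewrite [LHS]pcoef_mul pcoef_elt.
have bn : (b < n.+1)%N by rewrite ltnS (leq_trans bc).
rewrite (bigD1 (Ordinal bn)) //= !pcoef_elt /= eqxx big1 => [|w wb].
  rewrite addr0 andbT -natrM mulnb; congr (nat_of_bool _)%:R.
  apply/idP/idP => [/andP[/and4P[_ bv _ vc] /and3P[u0 ub ua]] | ].
    by rewrite u0 (leq_trans ub bv) ua vc.
  case/and4P=> u0 uv /eqP ua /eqP vc; rewrite ua vc !eqxx a0 ab bc.
  by rewrite (leq_trans a0 ab).
rewrite !pcoef_elt.
have -> : (w == b :> nat) = false.
  by apply: contraNF wb => /eqP wb; apply/eqP/val_inj.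
by rewrite !andbF mul0r.
Qed.

Definition monomial_ideal : {pred KQ} := fun x =>
  `[< forall a b : 'I_n.+1, good a b -> pcoef x a b = 0 >].

Lemma monomial_ideal_two_sided : two_sided_ideal monomial_ideal.
Proof.
split=> [|x y /asboolP x0 /asboolP y0|x y /asboolP y0].
- by apply/asboolP => a b _; rewrite pcoef0.
- by apply/asboolP => a b gab; rewrite pcoefD x0 // y0 // addr0.
split; apply/asboolP => a b gab; rewrite [LHS]pcoef_mul big1 // => c _.
all: have [cb | ncb] := boolP ((0 < c)%N && (c <= b)%N); last first.
1,3: by rewrite [X in X * _]pcoef_eq0 // mul0r.
all: have [ac | nac] := boolP ((0 < a)%N && (a <= c)%N); last first.
1,3: by rewrite [X in _ * X]pcoef_eq0 // mulr0.
all: have [gac gcb] := good_split rels gab (andP ac).2 (andP cb).2.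
  by rewrite y0 // mulr0.
by rewrite y0 // mul0r.
Qed.

Lemma path_elt_sum (x : KQ) :
  x = \sum_(p : lpath n) x p *: path_elt K n (src p) (tgt p).
Proof.
apply/ffunP => q; rewrite sum_ffunE (bigD1 q) //= !ffunE !eqxx big1 ?addr0.
  by rewrite [RHS]mulr1.
move=> p pq; rewrite !ffunE; case: eqP => [sqp|_]; last by rewrite [LHS]mulr0.
case: eqP => [tqp|_]; last by rewrite [LHS]mulr0.
case/eqP: pq; apply: val_inj; rewrite [LHS]surjective_pairing.
by rewrite [RHS]surjective_pairing; congr (_, _); apply: val_inj.
Qed.

(** The combinations of zero paths form a two-sided ideal containing the
    relations, whence one inclusion.  Conversely, a path from a to b with
    first_zero a <= b factors through a relation. *)
Lemma mem_generated (I : {pred KQ}) (x : KQ) :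
    generates I [seq rel_path K n k | k <- rho] ->
  x \in I <-> forall a b : 'I_n.+1, good a b -> pcoef x a b = 0.
Proof.
move=> [[I0 ID IM] rhoI Imin]; split=> [xI | x0].
  apply/asboolP; apply: (Imin _ monomial_ideal_two_sided) xI.
  move=> _ /mapP[k kr ->].
  apply/asboolP => a b gab; rewrite pcoef_elt.
  case: and4P => // -[_ _ /eqP ak /eqP bk].
  have [_ _ k2n] := rho_bound rels kr.
  have : (first_zero n rho a <= b)%N.
    rewrite bk; apply/(first_zero_leP rels) => //; exists k => //.
    by rewrite ak leqnn ltnSn.
  by case/and3P: gab => _ _; rewrite ltnNge => /negPf ->.
rewrite (path_elt_sum x); apply: (big_ind (fun y => y \in I)) => // p _.
have [a0 ab] := andP (valP p).
have [gp | ngp] := boolP (good (src p) (tgt p)).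
  by rewrite pcoefE x0 // scale0r.
have bn : (tgt p <= n)%N by rewrite -ltnS.
have : (first_zero n rho (src p) <= tgt p)%N.
  by move: ngp; rewrite /nonzero_path a0 ab /= -leqNgt.
case/(first_zero_leP rels _ bn)=> k kr /andP[ak kb].
have [k0 k12 k2n] := rho_bound rels kr.
pose z : KQ := x p *: path_elt K n k.2.+1 (tgt p).
have -> : x p *: path_elt K n (src p) (tgt p) =
    z * (rel_path K n k * path_elt K n (src p) k.1).
  rewrite path_elt_mul // ?(leq_trans (ltnW k12)) //.
  apply: pcoef_ext => u v; rewrite pcoefZ [RHS]pcoef_mul.
  under [RHS]eq_bigr do rewrite pcoefZ -mulrA.
  rewrite -mulr_sumr -pcoef_mul; congr (_ * pcoef _ u v).
  rewrite -[RHS]/(path_elt K n k.2.+1 (tgt p) * path_elt K n (src p) k.2.+1).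
  by rewrite path_elt_mul // (leq_trans ak) // (leq_trans (ltnW k12)).
have rI : rel_path K n k \in I by apply: rhoI; apply: map_f.
have [_ rI'] := IM (path_elt K n (src p) k.1) _ rI.
by have [] := IM z _ rI'.
Qed.

Lemma bound_quiver_coordinates (I : {pred KQ}) (A : falgType K) :
    generates I [seq rel_path K n k | k <- rho] ->
  bound_quiver_algebra I A -> inhabited (coordinates A n rho).
Proof.
move=> genI [pi [[pi1 piM] pi_surj piI]].
have [sec secK] := choice pi_surj.
have eq_pi (x y : KQ) (a b : 'I_n.+1) : pi x = pi y -> good a b ->
    pcoef x a b = pcoef y a b.
  move=> xy gab; have : x - y \in I by rewrite piI linearB xy subrr.
  move/(mem_generated _ genI)/(_ a b gab)/eqP.
  by rewrite -scaleN1r pcoefD pcoefZ mulN1r subr_eq0 => /eqP.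
pose cf (x : A) a b :=
  if good a b then pcoef (sec x) (inord a) (inord b) else 0.
have inE a b : good a b -> [/\ (inord a : 'I_n.+1) = a :> nat,
    (inord b : 'I_n.+1) = b :> nat &
    good (inord a : 'I_n.+1) (inord b : 'I_n.+1)].
  move=> gab; have bn := good_le rels gab; have /and3P[_ ab _] := gab.
  by rewrite !inordK // ltnS (leq_trans ab).
have cfE x y a b :
    pi y = x -> good a b -> cf x a b = pcoef y (inord a) (inord b).
  move=> yx gab; rewrite /cf gab; apply: eq_pi; first by rewrite secK.
  by have [] := inE _ _ gab.
constructor; apply: (@Coordinates K A n rho cf).
- move=> c x y a b; have [gab | ngab] := boolP (good a b); last first.
    by rewrite /cf (negPf ngab) mulr0 addr0.
  rewrite (cfE _ (c *: sec x + sec y)) ?linearP ?secK //.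
  by rewrite pcoefD pcoefZ /cf gab.
- move=> x y a b gab; have [aE bE gab'] := inE _ _ gab.
  rewrite (cfE _ (sec x * sec y)) ?piM ?secK // [LHS]pcoef_mul.
  have bn := good_le rels gab; have /and3P[a0 ab _] := gab.
  pose F c :=
    pcoef (sec x) (inord c) (inord b) * pcoef (sec y) (inord a) (inord c).
  transitivity (\sum_(c < n.+1) F c).
    by apply: eq_bigr => c _; rewrite /F inord_val.
  rewrite -(big_mkord xpredT F) (@big_cat_nat _ _ _ a) //=; last first.
    by rewrite (leq_trans ab) // ltnW.
  rewrite (@big_cat_nat _ _ _ b.+1 a) //=; last exact: leqW.
  rewrite big1_seq => [|c]; last first.
    rewrite mem_index_iota => /andP[_ /andP[_ ca]]; have cn : (c < n.+1)%N.
      by rewrite ltnS (leq_trans (ltnW ca)) // (leq_trans ab).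
    rewrite /F [X in _ * X]pcoef_eq0 ?mulr0 //.
    by rewrite negb_and -!ltnNge aE inordK // ca orbT.
  rewrite [X in _ + (_ + X)]big1_seq => [|c]; last first.
    rewrite mem_index_iota => /andP[_ /andP[bc cn]].
    rewrite /F [X in X * _]pcoef_eq0 ?mul0r //.
    by rewrite negb_and -!ltnNge bE inordK // bc orbT.
  rewrite add0r addr0; apply: eq_big_nat => c /andP[ac]; rewrite ltnS => cb.
  by have [gac gcb] := good_split rels gab ac cb; rewrite /F /cf gac gcb.
- move=> a b gab; have [aE bE gab'] := inE _ _ gab.
  rewrite (cfE _ 1) // [LHS]pcoef_one aE; have /and3P[-> _ _] := gab.
  by rewrite andbT -val_eqE /= aE bE.
- move=> x y xy; rewrite -[x]secK -[y]secK; apply/eqP.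
  rewrite -subr_eq0 -linearB -piI; apply/(mem_generated _ genI) => a b gab.
  have := xy a b gab; rewrite /cf gab !inord_val => e.
  by rewrite -scaleN1r pcoefD pcoefZ mulN1r e subrr.
- move=> g; exists (pi [ffun p => g (src p) (tgt p)]) => a b gab.
  have [aE bE gab'] := inE _ _ gab.
  rewrite (cfE _ [ffun p => g (src p) (tgt p)]) // /pcoef insubT /=.
    by move: gab'; rewrite aE bE => /and3P[-> ->].
  by move=> p; rewrite ffunE aE bE.
Qed.

End BoundQuiver.

Theorem proposition4p3 (K : closedFieldType) (n : nat)
    (I : {pred path_alg K n}) (A : falgType K)
    (r : nat) (rho : seq (nat * nat)) :
  admissible I ->
  bound_quiver_algebra I A ->
  nakayama A ->
  ~ semisimple_ring A ->
  has_lambda1 A r ->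
  defining_relations I rho ->
  (has_gldim A r <-> forms_chain rho).
Proof.
move=> _ bqA _ nssA lamA [bound sorted1 sorted2 [genI _]].
have rels : path_relations n rho by [].
have [C] := bound_quiver_coordinates rels genI bqA.
have n1 : (1 < n)%N.
  rewrite ltnNge; apply/negP => n1; apply: nssA.
  exact: (semisimple_n1 rels C).
rewrite (lambda1_size rels C lamA (ltnW n1)).
exact: (has_gldim_chain rels C).
Qed.
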